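(* Let $\mathbb{K}$ be a finite commutative unital ring, let $p\geq 2$ be a prime number, and let $\mathbb{F}_q$ be a finite field of characteristic $p$. Then: (1) the Riordan group $\mathcal{R}(\mathbb{K})$ is profinite; (2) the Riordan group $\mathcal{R}(\mathbb{F}_q)$ is a pro-$p$-group with finite width; (3) the Riordan groups $\mathcal{R}(\mathbb{F}_p)$ and $\mathcal{R}(\mathbb{Z})$ are topologically finitely generated. Furthermore, for every topologically generating set $S_N$ of the Nottingham group $\mathcal{N}(\mathbb{F}_p)$ (respectively $\mathcal{N}(\mathbb{Z})$), the group $\mathcal{R}(\mathbb{F}_p)$ (respectively $\mathcal{R}(\mathbb{Z})$) is topologically generated by $$\{(1+x,x)\}\cup\{(1,g): g\in S_N\}.$$
   Context: Let $\mathbb{N}=\{1,2,\dots\}$. For a unital commutative ring $\mathbb{K}$: - $\mathcal{H}(\mathbb{K})=\{1+a_1x+a_2x^2+\cdots\in\mathbb{K}[[x]]\}$ is a group under multiplication of power series. - $\mathcal{N}(\mathbb{K})=\{x+a_2x^2+a_3x^3+\cdots\in\mathbb{K}[[x]]\}$ (the Nottingham group) is a group under $h\circ g:=g(h)$ (substitute $h$ into $g$). - The Riordan group is the semidirect product $\mathcal{R}(\mathbb{K})=\mathcal{H}(\mathbb{K})\rtimes\mathcal{N}(\mathbb{K})$ for the action $\varphi(g)(h)=h(g)$, i.e. the set of pairs $(h,g)$ with $(h_1,g_1)(h_2,g_2)=(h_1\cdot h_2(g_1),\,g_2(g_1))$. - For $n\ge1$, $\mathcal{H}^n(\mathbb{K})$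 is the set of $h\in\mathcal{H}(\mathbb{K})$ of the form $1+a_nx^n+a_{n+1}x^{n+1}+\cdots$, $\mathcal{N}^n(\mathbb{K})$ is the set of $g\in\mathcal{N}(\mathbb{K})$ of the form $x+a_{n+1}x^{n+1}+a_{n+2}x^{n+2}+\cdots$, and $\mathcal{R}^n(\mathbb{K})=\mathcal{H}^n(\mathbb{K})\rtimes\mathcal{N}^n(\mathbb{K})$, a normal subgroup of $\mathcal{R}(\mathbb{K})$. - $\mathcal{R}(\mathbb{K})$ carries the inverse limit topology from $\mathcal{R}(\mathbb{K})=\varprojlim \mathcal{R}(\mathbb{K})/\mathcal{R}^n(\mathbb{K})$, with each quotient discrete; $\mathcal{N}(\mathbb{K})=\varprojlim\mathcal{N}(\mathbb{K})/\mathcal{N}^n(\mathbb{K})$ is topologized in the same way. A subset $S$ of a topological group $G$ topologically generates $G$ if the subgroup $\langle S\rangle$ is dense in $G$; $G$ is topologically finitely generated if it has a finite topologically generating set. Commutators are $[g,h]=ghg^{-1}h^{-1}$; $[G_1,G_2]$ is the subgroup generated by all $[g_1,g_2]$ with $g_i\in G_i$; $\gamma_2(G)=[G,G]$, $\gamma_n(G)=[G,\gamma_{n-1}(G)]$ for $n\ge3$ (and $\gamma_1(G)=G$). An infinite pro-$p$-group $G$ has finite width if $\sup_n\log_p|\gamma_n(G)/\gamma_{n+1}(G)|<\infty$. *)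

(* Defs.v *)
From HB Require Import structures.
From mathcomp Require Import all_boot all_order all_algebra.
From mathcomp Require Import all_classical.
From mathcomp Require Import topology.

Set Implicit Arguments.
Unset Strict Implicit.
Unset Printing Implicit Defensive.

Import GRing.Theory.
Local Open Scope classical_set_scope.
Local Open Scope ring_scope.

Record fps (K : Type) := FPS { fps_coef :> nat -> K }.

Lemma fps_coefK (K : Type) : cancel (@fps_coef K) (@FPS K).
Proof. by case. Qed.

HB.instance Definition _ (K : choiceType) :=
  Choice.copy (fps K) (can_type (@fps_coefK K)).

Lemma fpsP (K : Type) (f g : fps K) : (forall n, f n = g n) <-> f = g.
Proof.
split=> [fg|->//]; rewrite -[f]fps_coefK -[g]fps_coefK; congr FPS.
exact/funext.
Qed.

Section FpsRing.
Variable K : comPzRingType.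
Implicit Types f g h : fps K.

Definition fps_zero : fps K := FPS (fun=> 0).
Definition fps_add f g : fps K := FPS (fun n => f n + g n).
Definition fps_opp f : fps K := FPS (fun n => - f n).
Definition fps_one : fps K := FPS (fun n => (n == 0%N)%:R).
Definition fps_mul f g : fps K :=
  FPS (fun n => \sum_(i < n.+1) f i * g (n - i)%N).

Fact fps_addA : associative fps_add.
Proof. by move=> f g h; apply/fpsP => n /=; rewrite addrA. Qed.

Fact fps_addC : commutative fps_add.
Proof. by move=> f g; apply/fpsP => n /=; rewrite addrC. Qed.

Fact fps_add0 : left_id fps_zero fps_add.
Proof. by move=> f; apply/fpsP => n /=; rewrite add0r. Qed.

Fact fps_addN : left_inverse fps_zero fps_opp fps_add.
Proof. by move=> f; apply/fpsP => n /=; rewrite addNr. Qed.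

HB.instance Definition _ :=
  GRing.isZmodule.Build (fps K) fps_addA fps_addC fps_add0 fps_addN.

Lemma fps_mul_rev f g n :
  fps_mul f g n = \sum_(i < n.+1) f (n - i)%N * g i.
Proof.
rewrite /= (reindex_inj rev_ord_inj) /=.
by apply: eq_bigr => i _; rewrite subSS sub_ordK.
Qed.

Fact fps_mulC : commutative fps_mul.
Proof.
move=> f g; apply/fpsP => n; rewrite [LHS]fps_mul_rev.
by apply: eq_bigr => i _; rewrite mulrC.
Qed.

Fact fps_mulA : associative fps_mul.
Proof.
move=> p q r; apply/fpsP => i; rewrite [RHS]fps_mul_rev.
pose coef3 j k := p j * (q (i - j - k)%N * r k).
transitivity (\sum_(j < i.+1) \sum_(k < i.+1 | (k <= i - j)%N) coef3 j k).
  apply: eq_bigr => /= j _; have /= -> := fps_mul_rev q r (i - j)%N.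
  by rewrite big_distrr /= (big_ord_narrow_leq (leq_subr _ _)).
rewrite (exchange_big_dep predT) //=; apply: eq_bigr => k _.
transitivity (\sum_(j < i.+1 | (j <= i - k)%N) coef3 j k).
  apply: eq_bigl => j; rewrite -ltnS -(ltnS j) -!subSn ?leq_ord //.
  by rewrite -subn_gt0 -(subn_gt0 j) -!subnDA addnC.
rewrite (big_ord_narrow_leq (leq_subr _ _)) big_distrl /=.
by apply: eq_bigr => j _; rewrite /coef3 -!subnDA addnC mulrA.
Qed.

Fact fps_mul1 : left_id fps_one fps_mul.
Proof.
move=> f; apply/fpsP => n /=; rewrite big_ord_recl /= mul1r subn0.
by rewrite big1 ?addr0 // => i _; rewrite mul0r.
Qed.

Fact fps_mulDl : left_distributive fps_mul fps_add.
Proof.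
move=> f g h; apply/fpsP => n /=; rewrite -big_split /=.
by apply: eq_bigr => i _; rewrite mulrDl.
Qed.

HB.instance Definition _ := GRing.Zmodule_isComPzRing.Build (fps K)
  fps_mulA fps_mulC fps_mul1 fps_mulDl.

Lemma fps0E n : (0 : fps K) n = 0. Proof. by []. Qed.
Lemma fpsDE f g n : (f + g) n = f n + g n. Proof. by []. Qed.
Lemma fps1E n : (1 : fps K) n = (n == 0%N)%:R. Proof. by []. Qed.
Lemma fpsME f g n : (f * g) n = \sum_(i < n.+1) f i * g (n - i)%N.
Proof. by []. Qed.

Lemma fpsM0E f g : (f * g) 0%N = f 0%N * g 0%N.
Proof. by rewrite fpsME big_ord1. Qed.

Definition fpsX : fps K := FPS (fun n => (n == 1%N)%:R).

(* [fps_comp f g] is the series [f(g)]; the formula is the substitution only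
   when [g] has zero constant coefficient, since then [g ^+ i] does not
   contribute to the coefficients of index [n < i]. *)
Definition fps_comp f g : fps K :=
  FPS (fun n => \sum_(i < n.+1) f i * (g ^+ i) n).

Lemma fps_expr_lt g i n : g 0%N = 0 -> (n < i)%N -> (g ^+ i) n = 0.
Proof.
move=> g0; elim: i n => // i IH n ni; rewrite exprS fpsME.
apply: big1 => -[[|j] /= jn] _; first by rewrite g0 mul0r.
by rewrite IH ?mulr0 // ltn_subLR // addSnnS ltn_addl.
Qed.

Lemma fps_expr_diag g i : g 0%N = 0 -> g 1%N = 1 -> (g ^+ i) i = 1.
Proof.
move=> g0 g1; elim: i => // i IH; rewrite exprS fpsME.
rewrite big_ord_recl g0 mul0r add0r big_ord_recl /= g1 mul1r subSS subn0 IH.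
rewrite big1 ?addr0 // => j _; rewrite fps_expr_lt ?mulr0 //=.
by rewrite /bump /= !add1n subSS ltn_subLR ?addSnnS ?ltn_addl.
Qed.

Lemma fps_compE f g N n : g 0%N = 0 -> (n <= N)%N ->
  fps_comp f g n = \sum_(i < N.+1) f i * (g ^+ i) n.
Proof.
move=> g0 nN; rewrite /= (big_ord_widen N.+1 (fun i => f i * (g ^+ i) n)) //.
rewrite [RHS](bigID (fun i : 'I_N.+1 => (i < n.+1)%N)) /=.
rewrite [X in _ + X]big1 ?addr0 // => i; rewrite -leqNgt => ni.
by rewrite fps_expr_lt ?mulr0.
Qed.

Lemma fps_comp_coef0 f g : fps_comp f g 0%N = f 0%N.
Proof. by rewrite /= big_ord1 expr0 fps1E mulr1. Qed.

Lemma fps_compX f : fps_comp f fpsX = f.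
Proof.
have X0 : fpsX 0%N = 0 by [].
have XS g n : (fpsX * g) n.+1 = g n.
  rewrite fpsME big_ord_recl mul0r add0r big_ord_recl mul1r subSS subn0.
  by rewrite big1 ?addr0 // => i _; rewrite mul0r.
have XnE i n : (fpsX ^+ i) n = (n == i)%:R.
  elim: i n => // i IH [|n]; first by rewrite exprS fpsM0E X0 mul0r.
  by rewrite exprS XS IH eqSS.
apply/fpsP => n /=; rewrite big_ord_recr /= XnE eqxx mulr1 big1 ?add0r // => i _.
by rewrite XnE gtn_eqF ?mulr0.
Qed.

Lemma fps_comp1 g : fps_comp 1 g = 1.
Proof.
apply/fpsP => n /=; rewrite big_ord_recl expr0 mul1r big1 ?addr0 // => i _.
by rewrite mul0r.
Qed.

Lemma fps_compXl g : g 0%N = 0 -> fps_comp fpsX g = g.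
Proof.
move=> g0; apply/fpsP => -[|n] /=; first by rewrite big_ord1 mul0r g0.
rewrite big_ord_recl mul0r add0r big_ord_recl mul1r expr1.
by rewrite big1 ?addr0 // => i _; rewrite mul0r.
Qed.

Lemma sum_ord_shift (F : nat -> K) n a :
  (a <= n)%N -> (forall i, (n < i)%N -> F i = 0) ->
  \sum_(i < n.+1 | (a <= i)%N) F i = \sum_(b < n.+1) F (a + b)%N.
Proof.
move=> an F0; rewrite -(big_mkord (fun i => (a <= i)%N) F).
rewrite (big_cat_nat (n := a)) ?leqW //= big_nat_cond big1 => [|i]; last first.
  by case/andP=> /andP[_ ia]; rewrite leqNgt ia.
rewrite add0r big_nat_cond (eq_bigl (fun i => (a <= i < n.+1)%N && true)).
  rewrite -big_nat_cond -{1}[a]add0n big_addn.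
  rewrite -(big_mkord xpredT (fun b => F (a + b)%N)).
  rewrite [RHS](big_cat_nat (n := n.+1 - a)) ?leq_subr //=.
  rewrite [X in _ = _ + X]big_nat_cond [X in _ = _ + X]big1 => [|b].
    by rewrite addr0; apply: eq_bigr => b _; rewrite addnC.
  by rewrite andbT => /andP[+ _]; rewrite leq_subLR => /F0.
by move=> i; case: (a <= i)%N; rewrite ?andbF.
Qed.

Lemma fps_compM f k g : g 0%N = 0 ->
  fps_comp (f * k) g = fps_comp f g * fps_comp k g.
Proof.
move=> g0; apply/fpsP => n; rewrite fpsME.
transitivity (\sum_(a < n.+1) \sum_(b < n.+1) f a * k b * (g ^+ (a + b)) n).
  transitivity (\sum_(i < n.+1) \sum_(a < n.+1 | (a <= i)%N)
      f a * k (i - a)%N * (g ^+ i) n).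
    rewrite /fps_comp [LHS]/fps_coef; apply: eq_bigr => i _.
    rewrite fpsME big_distrl.
    by rewrite (big_ord_widen n.+1 (fun a => f a * k (i - a)%N * (g ^+ i) n)).
  rewrite (exchange_big_dep predT) //; apply: eq_bigr => a _.
  rewrite (@sum_ord_shift (fun i => f a * k (i - a)%N * (g ^+ i) n)) -1?ltnS //.
    by apply: eq_bigr => b _; rewrite addKn.
  by move=> i ni; rewrite fps_expr_lt ?mulr0.
transitivity (\sum_(u < n.+1) \sum_(a < n.+1) \sum_(b < n.+1)
    f a * k b * ((g ^+ a) u * (g ^+ b) (n - u)%N)).
  rewrite [RHS]exchange_big; apply: eq_bigr => a _.
  rewrite [RHS]exchange_big; apply: eq_bigr => b _.
  by rewrite exprD fpsME mulr_sumr.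
apply: eq_bigr => u _.
rewrite (@fps_compE f g n) -1?ltnS // (@fps_compE k g n) ?leq_subr //.
rewrite big_distrl /=; apply: eq_bigr => a _.
rewrite big_distrr /=; apply: eq_bigr => b _.
by rewrite mulrACA.
Qed.

Lemma fps_compXn f g i : g 0%N = 0 -> fps_comp (f ^+ i) g = fps_comp f g ^+ i.
Proof.
move=> g0; elim: i => [|i IH]; first by rewrite !expr0 fps_comp1.
by rewrite !exprS fps_compM // IH.
Qed.

Lemma fps_compA f g h : g 0%N = 0 -> h 0%N = 0 ->
  fps_comp (fps_comp f g) h = fps_comp f (fps_comp g h).
Proof.
move=> g0 h0; apply/fpsP => n.
transitivity (\sum_(i < n.+1) \sum_(j < n.+1) f j * ((g ^+ j) i * (h ^+ i) n)).
  apply: eq_bigr => i _; have -> := @fps_compE f g n i g0; last by rewrite -ltnS.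
  rewrite big_distrl /=.
  by apply: eq_bigr => j _; rewrite mulrA.
rewrite exchange_big /=; apply: eq_bigr => j _.
by rewrite -big_distrr /= -fps_compXn.
Qed.

(* The solution [s] of [s n = F n (s 0, ..., s n.-1)]. *)
Fixpoint rec_pref (F : nat -> (nat -> K) -> K) (n : nat) : nat -> K :=
  if n is m.+1 then
    fun i => if i == m then F m (rec_pref F m) else rec_pref F m i
  else fun=> 0.
Definition rec_sol F : fps K := FPS (fun n => rec_pref F n.+1 n).

Lemma rec_solE F n :
  (forall s t, (forall i, (i < n)%N -> s i = t i) -> F n s = F n t) ->
  rec_sol F n = F n (rec_sol F).
Proof.
move=> FE; rewrite /= eqxx; apply: FE => i.
elim: n => // n IH; rewrite ltnS leq_eqVlt => /predU1P[->|i_n] /=.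
  by rewrite eqxx.
by rewrite ltn_eqF // IH //= eqxx.
Qed.

Definition fps_inv f : fps K :=
  rec_sol (fun n s => (n == 0%N)%:R - \sum_(i < n) s i * f (n - i)%N).

Lemma fps_invE f n : fps_inv f n =
  (n == 0%N)%:R - \sum_(i < n) fps_inv f i * f (n - i)%N.
Proof.
apply: rec_solE => s t st.
by congr (_ - _); apply: eq_bigr => i _; rewrite st.
Qed.

Lemma fps_invP f : f 0%N = 1 -> fps_inv f * f = 1.
Proof.
move=> f0; apply/fpsP => n; rewrite fpsME big_ord_recr [nat_of_ord ord_max]/=.
by rewrite subnn f0 mulr1 (fps_invE f n); exact: subrKC.
Qed.

(* The inverse for substitution of [g = x + a_2 x^2 + ...]: the coefficient of
   index [n] of [s(g)] is [s n + \sum_(i < n) s i * (g ^+ i) n]. *)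
Definition fps_compinv g : fps K :=
  rec_sol (fun n s => (n == 1%N)%:R - \sum_(i < n) s i * (g ^+ i) n).

Lemma fps_compinvE g n : fps_compinv g n =
  (n == 1%N)%:R - \sum_(i < n) fps_compinv g i * (g ^+ i) n.
Proof.
apply: rec_solE => s t st.
by congr (_ - _); apply: eq_bigr => i _; rewrite st.
Qed.

Lemma fps_compinvP g : g 0%N = 0 -> g 1%N = 1 ->
  fps_comp (fps_compinv g) g = fpsX.
Proof.
move=> g0 g1; apply/fpsP => n.
rewrite [LHS]big_ord_recr [nat_of_ord ord_max]/= fps_expr_diag // mulr1.
by rewrite (fps_compinvE g n); exact: subrKC.
Qed.

End FpsRing.

Section Groups.
Variable K : comPzRingType.

(* [H(K)] *)
Record useries := USeries { us_val : fps K; _ : us_val 0%N == 1 }.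
HB.instance Definition _ := [isSub for us_val].
HB.instance Definition _ := [Choice of useries by <:].

Lemma useriesP (h : useries) : us_val h 0%N = 1.
Proof. by case: h => h /= /eqP. Qed.

Fact us_one_subproof : (1 : fps K) 0%N == 1. Proof. by rewrite fps1E. Qed.
Definition us_one := USeries us_one_subproof.

Fact us_mul_subproof (f g : useries) : (us_val f * us_val g) 0%N == 1.
Proof. by rewrite fpsM0E !useriesP mulr1. Qed.
Definition us_mul (f g : useries) := USeries (us_mul_subproof f g).

Fact us_inv_subproof (f : useries) : fps_inv (us_val f) 0%N == 1.
Proof.
have /fpsP/(_ 0%N) := fps_invP (useriesP f).
by rewrite fpsM0E useriesP mulr1 => ->.
Qed.
Definition us_inv (f : useries) := USeries (us_inv_subproof f).

Fact us_mulA : associative us_mul.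
Proof. by move=> f g h; apply: val_inj; rewrite /= mulrA. Qed.
Fact us_mul1 : left_id us_one us_mul.
Proof. by move=> f; apply: val_inj; rewrite /= mul1r. Qed.
Fact us_mulr1 : right_id us_one us_mul.
Proof. by move=> f; apply: val_inj; rewrite /= mulr1. Qed.
Fact us_mulV : left_inverse us_one us_inv us_mul.
Proof. by move=> f; apply: val_inj; rewrite /= fps_invP // useriesP. Qed.
Fact us_mulrV : right_inverse us_one us_inv us_mul.
Proof. by move=> f; apply: val_inj; rewrite /= mulrC fps_invP // useriesP. Qed.

HB.instance Definition _ := isGroup.Build useries
  us_mulA us_mul1 us_mulr1 us_mulV us_mulrV.

(* [N(K)] *)
Record nottingham := Nottingham {
  nt_val : fps K; _ : (nt_val 0%N == 0) && (nt_val 1%N == 1) }.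
HB.instance Definition _ := [isSub for nt_val].
HB.instance Definition _ := [Choice of nottingham by <:].

Lemma nottingham0 (g : nottingham) : nt_val g 0%N = 0.
Proof. by case: g => g /= /andP[/eqP]. Qed.
Lemma nottingham1 (g : nottingham) : nt_val g 1%N = 1.
Proof. by case: g => g /= /andP[_ /eqP]. Qed.

Fact nt_one_subproof : (fpsX K 0%N == 0) && (fpsX K 1%N == 1).
Proof. by rewrite /= !eqxx. Qed.
Definition nt_one := Nottingham nt_one_subproof.

Fact nt_mul_subproof (h g : nottingham) :
  (fps_comp (nt_val g) (nt_val h) 0%N == 0) &&
  (fps_comp (nt_val g) (nt_val h) 1%N == 1).
Proof.
rewrite fps_comp_coef0 nottingham0 eqxx /=.
rewrite big_ord_recl big_ord1 /= nottingham0 mul0r add0r expr1.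
by rewrite !nottingham1 mulr1.
Qed.
(* The group law of [N(K)] is [h g := g(h)]. *)
Definition nt_mul (h g : nottingham) := Nottingham (nt_mul_subproof h g).

Fact nt_inv_subproof (g : nottingham) :
  (fps_compinv (nt_val g) 0%N == 0) && (fps_compinv (nt_val g) 1%N == 1).
Proof.
have /fpsP gP := fps_compinvP (nottingham0 g) (nottingham1 g).
have k0 : fps_compinv (nt_val g) 0%N = 0.
  by have := gP 0%N; rewrite fps_comp_coef0.
rewrite k0 eqxx /=; have := gP 1%N.
rewrite [X in X = _ -> _]big_ord_recl big_ord1 [X in X * _]k0 mul0r add0r.
by rewrite expr1 nottingham1 mulr1 => k1; apply/eqP.
Qed.
Definition nt_inv (g : nottingham) := Nottingham (nt_inv_subproof g).

Fact nt_mulA : associative nt_mul.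
Proof.
by move=> f g h; apply: val_inj; rewrite /= fps_compA // nottingham0.
Qed.
Fact nt_mul1 : left_id nt_one nt_mul.
Proof. by move=> f; apply: val_inj; rewrite /= fps_compX. Qed.
Fact nt_mulr1 : right_id nt_one nt_mul.
Proof. by move=> f; apply: val_inj; rewrite /= fps_compXl // nottingham0. Qed.
Fact nt_mulrV : right_inverse nt_one nt_inv nt_mul.
Proof.
move=> f; apply: val_inj; rewrite /= fps_compinvP //.
  exact: nottingham0.
exact: nottingham1.
Qed.
Fact nt_mulV : left_inverse nt_one nt_inv nt_mul.
Proof.
move=> f; have E := nt_mulrV (nt_inv f).
transitivity (nt_mul (nt_mul (nt_inv f) f)
    (nt_mul (nt_inv f) (nt_inv (nt_inv f)))); first by rewrite E nt_mulr1.
by rewrite nt_mulA -(nt_mulA (nt_inv f) f) nt_mulrV nt_mulr1.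
Qed.

HB.instance Definition _ := isGroup.Build nottingham
  nt_mulA nt_mul1 nt_mulr1 nt_mulV nt_mulrV.

(* The action [h |-> h(g)] of [N(K)] on [H(K)]. *)
Fact us_subst_subproof (g : nottingham) (h : useries) :
  fps_comp (us_val h) (nt_val g) 0%N == 1.
Proof. by rewrite fps_comp_coef0 useriesP. Qed.
Definition us_subst (g : nottingham) (h : useries) :=
  USeries (us_subst_subproof g h).

Lemma us_substM g h k :
  us_subst g (h * k)%g = (us_subst g h * us_subst g k)%g.
Proof. by apply: val_inj; rewrite /= fps_compM // nottingham0. Qed.
Lemma us_subst1 g : us_subst g 1%g = 1%g.
Proof. by apply: val_inj; rewrite /= fps_comp1. Qed.
Lemma us_substA f g h : us_subst (f * g)%g h = us_subst f (us_subst g h).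
Proof. by apply: val_inj; rewrite /= fps_compA // nottingham0. Qed.
Lemma us_subst_id h : us_subst 1%g h = h.
Proof. by apply: val_inj; rewrite /= fps_compX. Qed.

Record riordan := Riordan { rd_h : useries; rd_g : nottingham }.

Definition riordan_pair r := (rd_h r, rd_g r).
Definition pair_riordan x := Riordan x.1 x.2.
Lemma riordan_pairK : cancel riordan_pair pair_riordan. Proof. by case. Qed.
HB.instance Definition _ := Choice.copy riordan (can_type riordan_pairK).

Definition rd_one := Riordan 1%g 1%g.
Definition rd_mul r s :=
  Riordan (rd_h r * us_subst (rd_g r) (rd_h s))%g (rd_g r * rd_g s)%g.
Definition rd_inv r :=
  Riordan (us_subst (rd_g r)^-1%g (rd_h r)^-1%g) (rd_g r)^-1%g.

Fact rd_mulA : associative rd_mul.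
Proof.
move=> r s t; congr Riordan => /=; last by rewrite mulgA.
by rewrite us_substM us_substA mulgA.
Qed.
Fact rd_mul1 : left_id rd_one rd_mul.
Proof. by case=> h g; congr Riordan; rewrite /= ?mul1g ?us_subst_id. Qed.
Fact rd_mulr1 : right_id rd_one rd_mul.
Proof. by case=> h g; congr Riordan; rewrite /= ?us_subst1 mulg1. Qed.
Fact rd_mulV : left_inverse rd_one rd_inv rd_mul.
Proof.
case=> h g; congr Riordan; rewrite /= ?mulVg //.
by rewrite -us_substM mulVg us_subst1.
Qed.
Fact rd_mulrV : right_inverse rd_one rd_inv rd_mul.
Proof.
case=> h g; congr Riordan; rewrite /= ?mulgV //.
by rewrite -us_substA mulgV us_subst_id mulgV.
Qed.

HB.instance Definition _ := isGroup.Build riordan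
  rd_mulA rd_mul1 rd_mulr1 rd_mulV rd_mulrV.

Fact us_1X_subproof : (1 + fpsX K) 0%N == 1.
Proof. by rewrite fpsDE fps1E /= addr0. Qed.
Definition us_1X := USeries us_1X_subproof.

(* The condition [0 < i] matters only for the trivial coefficient of index 0;
   in particular the subgroups of index [n = 0] and [n = 1] are the whole
   group, so indexing the filtrations by all of [nat] changes nothing. *)
Definition us_filt (n : nat) : set useries :=
  [set h | forall i, (0 < i < n)%N -> us_val h i = 0].
Definition nt_filt (n : nat) : set nottingham :=
  [set g | forall i, (1 < i <= n)%N -> nt_val g i = 0].
Definition rd_filt (n : nat) : set riordan :=
  [set r | us_filt n (rd_h r) /\ nt_filt n (rd_g r)].

End Groups.

Section GroupSets.
Local Open Scope group_scope.
Variable G : groupType.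
Implicit Types (A B : set G).

Definition is_subgroup A :=
  [/\ A 1, (forall x y, A x -> A y -> A (x * y)) & (forall x, A x -> A x^-1)].

Definition is_normal A := forall x y, A x -> A (y * x * y^-1).

Definition gen_subgroup (S : set G) : set G := smallest is_subgroup S.

Definition left_coset (x : G) A : set G := [set x * a | a in A].

(* [A / B], as a set of cosets. *)
Definition coset_space A B : set (set G) := [set left_coset x B | x in A].

Definition commg_subgroup A B : set G :=
  gen_subgroup [set g * h * g^-1 * h^-1 | g in A & h in B].

(* [lower_central n] is [gamma_n], indexed from 1; the value at 0 is junk. *)
Fixpoint lower_central (n : nat) : set G :=
  match n with
  | 0 | 1 => [set: G]
  | m.+1 => commg_subgroup [set: G] (lower_central m)
  end.

End GroupSets.
Arguments lower_central : clear implicits.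

HB.mixin Record isTopologicalGroup G of Topological G & Group G := {
  mulg_continuous : continuous (fun x : G * G => (x.1 * x.2)%g);
  invg_continuous : continuous (fun x : G => (x^-1)%g) }.

#[short(type="topologicalGroupType")]
HB.structure Definition TopologicalGroup :=
  {G of isTopologicalGroup G & Topological G & Group G}.

(* The inverse limit topology defined by a filtration [F] of [G] is the initial
   topology for the map from [G] to the product of the discrete spaces
   [G / F n]. *)
Lemma initial_cvg (S : choiceType) (T : topologicalType) (f : S -> T)
    (E : set_system S) (s : S) : Filter E ->
  E --> (s : initial_topology f) <-> f @ E --> f s.
Proof.
move=> FE; split=> [Es|fEs A].
  apply: (cvg_comp _ _ Es); exact: (@initial_continuous S T f).
rewrite nbhsE => -[B [[C Cop <-] Cs] sBA]; apply: filterS sBA _.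
by apply: fEs; exact: open_nbhs_nbhs.
Qed.

Section InverseLimitTopology.
Local Open Scope group_scope.
Variables (G : groupType) (F : nat -> set G).

Definition to_cosets (x : G) :
    prod_topology (fun _ : nat => discrete_topology (set G)) :=
  fun n => left_coset x (F n).

Definition invlim_topology := initial_topology to_cosets.

HB.instance Definition _ := Topological.on invlim_topology.

Lemma invlim_cvg (E : set_system invlim_topology) (x : invlim_topology) :
  Filter E -> E --> x <->
  forall n, E [set y : invlim_topology | to_cosets y n = to_cosets x n].
Proof.
move=> FE; split=> [/initial_cvg/cvg_sup xE n|xE].
  by have /initial_cvg/discrete_cvg := xE n; apply.
apply/initial_cvg/cvg_sup => n; apply/initial_cvg/discrete_cvg; exact: xE.
Qed.

Hypothesis F_subgroup : forall n, is_subgroup (F n).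
Hypothesis F_normal : forall n, is_normal (F n).

Lemma left_cosetP n (x y : G) :
  (left_coset x (F n) = left_coset y (F n)) <-> F n (y^-1 * x).
Proof.
have [F1 FM FV] := F_subgroup n.
split=> [xy|yx].
  have : left_coset x (F n) x by exists 1; rewrite ?mulg1.
  by rewrite xy => -[a Fa <-]; rewrite mulKg.
apply/seteqP; split=> _ [a Fa <-].
  by exists (y^-1 * x * a); [exact: FM|rewrite !mulgA mulgV mul1g].
exists ((y^-1 * x)^-1 * a); first exact/FM/Fa/FV.
by rewrite invgM invgK !mulgA mulgV mul1g.
Qed.

Lemma invlim_nbhs_coset n (x : invlim_topology) :
  nbhs x [set y : invlim_topology | F n ((x : G)^-1 * (y : G))].
Proof.
have /invlim_cvg/(_ n) : nbhs x --> x by [].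
apply: filterS => y /= xy.
exact/left_cosetP.
Qed.

Lemma invlim_mulg_continuous :
  continuous (fun x : invlim_topology * invlim_topology =>
    (x.1 : G) * (x.2 : G) : invlim_topology).
Proof.
move=> [x y]; apply/invlim_cvg => n /=.
exists ([set z | F n ((x : G)^-1 * (z : G))],
        [set z | F n ((y : G)^-1 * (z : G))]) => [|[u v] /= [xu yv]].
  by split; exact: invlim_nbhs_coset.
have [_ FM _] := F_subgroup n.
apply/left_cosetP; rewrite invgM.
have -> : (y : G)^-1 * (x : G)^-1 * ((u : G) * (v : G)) =
    ((y : G)^-1 * ((x : G)^-1 * (u : G)) * ((y : G)^-1)^-1)
      * ((y : G)^-1 * (v : G)).
  by rewrite invgK !mulgA mulgK.
by apply: FM => //; exact: F_normal.
Qed.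

Lemma invlim_invg_continuous :
  continuous (fun x : invlim_topology => (x : G)^-1 : invlim_topology).
Proof.
move=> x.
apply/(@invlim_cvg _ _
  (fmap_filter (fun y => (y : G)^-1) (nbhs_filter x))) => n /=.
apply: filterS (invlim_nbhs_coset n x) => u /= xu.
have [_ _ FV] := F_subgroup n.
apply/left_cosetP; rewrite invgK.
have := F_normal (x : G) (FV _ xu).
by rewrite invgM invgK !mulgA mulgK.
Qed.

End InverseLimitTopology.

Section CongruenceClass.
Local Open Scope group_scope.
Variables (G : groupType) (R : G -> G -> Prop).
Hypothesis R_refl : forall x, R x x.
Hypothesis R_sym : forall x y, R x y -> R y x.
Hypothesis R_trans : forall x y z, R x y -> R y z -> R x z.
Hypothesis R_mul : forall x x' y y', R x x' -> R y y' -> R (x * y) (x' * y').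

Lemma congr1_subgroup : is_subgroup [set x | R x 1].
Proof.
split=> [|x y /= x1 y1|x /= x1]; first exact: R_refl.
  by have := R_mul x1 y1; rewrite mulg1.
by have := R_mul (R_sym x1) (R_refl x^-1); rewrite mulgV mul1g.
Qed.

Lemma congr1_normal : is_normal [set x | R x 1].
Proof.
move=> x y /= x1; have := R_mul (R_mul (R_refl y) x1) (R_refl y^-1).
by rewrite mulg1 mulgV.
Qed.

End CongruenceClass.

Section Filtrations.
Variable K : comPzRingType.
Implicit Types f g : fps K.

Definition fps_eqmod n f g : Prop := forall i, (i < n)%N -> f i = g i.

Lemma fps_eqmodM n f f' g g' : fps_eqmod n f f' -> fps_eqmod n g g' ->
  fps_eqmod n (f * g) (f' * g').
Proof.
move=> ff gg i i_n; rewrite !fpsME; apply: eq_bigr => j _.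
rewrite ff ?gg //; first exact: leq_ltn_trans (leq_subr _ _) i_n.
by apply: leq_ltn_trans i_n; rewrite -ltnS.
Qed.

Lemma fps_eqmodX n f g k : fps_eqmod n f g -> fps_eqmod n (f ^+ k) (g ^+ k).
Proof.
by move=> fg; elim: k => // k IH; rewrite !exprS; exact: fps_eqmodM.
Qed.

Lemma fps_eqmod_comp n f f' g g' : fps_eqmod n f f' -> fps_eqmod n g g' ->
  fps_eqmod n (fps_comp f g) (fps_comp f' g').
Proof.
move=> ff gg i i_n; apply: eq_bigr => j _; congr (_ * _).
  by apply: ff; apply: leq_ltn_trans i_n; rewrite -ltnS.
exact: (@fps_eqmodX n g g' j gg).
Qed.

Definition nt_eqmod n (g g' : nottingham K) : Prop :=
  fps_eqmod n.+1 (nt_val g) (nt_val g').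
Definition rd_eqmod n (r r' : riordan K) : Prop :=
  fps_eqmod n (us_val (rd_h r)) (us_val (rd_h r')) /\
  nt_eqmod n (rd_g r) (rd_g r').

Lemma nt_filtE n : @nt_filt K n = [set g | nt_eqmod n g 1%g].
Proof.
apply/seteqP; split=> g /= gP.
  move=> [|[|i]] i_n; rewrite ?nottingham0 ?nottingham1 //; exact: gP.
by move=> [|[|i]] // /andP[_ i_n]; rewrite gP.
Qed.

Lemma rd_filtE n : @rd_filt K n = [set r | rd_eqmod n r 1%g].
Proof.
apply/seteqP; split=> r; rewrite /rd_filt /= nt_filtE => -[hP gP]; split=> //.
  by move=> [|i] i_n; rewrite ?useriesP //; exact: hP.
by move=> [|i] // /andP[_ i_n]; rewrite hP.
Qed.

Lemma nt_eqmodM n x x' y y' : nt_eqmod n x x' -> nt_eqmod n y y' ->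
  nt_eqmod n (x * y)%g (x' * y')%g.
Proof. by move=> xx yy; exact: fps_eqmod_comp. Qed.

Lemma rd_eqmodM n x x' y y' : rd_eqmod n x x' -> rd_eqmod n y y' ->
  rd_eqmod n (x * y)%g (x' * y')%g.
Proof.
move=> [xh xg] [yh yg]; split; last exact: nt_eqmodM.
apply: fps_eqmodM => //; apply: fps_eqmod_comp => // i i_n.
exact/xg/ltnW.
Qed.

Lemma nt_filt_subgroup n : is_subgroup (@nt_filt K n).
Proof.
rewrite nt_filtE; apply: congr1_subgroup => //.
- by move=> x y xy i i_n; rewrite xy.
- exact: nt_eqmodM.
Qed.

Lemma nt_filt_normal n : is_normal (@nt_filt K n).
Proof. by rewrite nt_filtE; apply: congr1_normal => //; exact: nt_eqmodM. Qed.

Lemma rd_filt_subgroup n : is_subgroup (@rd_filt K n).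
Proof.
rewrite rd_filtE; apply: congr1_subgroup => //.
- by move=> x y [xyh xyg]; split=> i i_n; rewrite (xyh, xyg).
- exact: rd_eqmodM.
Qed.

Lemma rd_filt_normal n : is_normal (@rd_filt K n).
Proof. by rewrite rd_filtE; apply: congr1_normal => //; exact: rd_eqmodM. Qed.

HB.instance Definition _ := Topological.copy (nottingham K)
  (invlim_topology (@nt_filt K)).
HB.instance Definition _ := isTopologicalGroup.Build (nottingham K)
  (invlim_mulg_continuous nt_filt_subgroup nt_filt_normal)
  (invlim_invg_continuous nt_filt_subgroup nt_filt_normal).

HB.instance Definition _ := Topological.copy (riordan K)
  (invlim_topology (@rd_filt K)).
HB.instance Definition _ := isTopologicalGroup.Build (riordan K)
  (invlim_mulg_continuous rd_filt_subgroup rd_filt_normal)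
  (invlim_invg_continuous rd_filt_subgroup rd_filt_normal).

End Filtrations.

Definition top_generates (G : topologicalGroupType) (S : set G) : Prop :=
  dense (gen_subgroup S).

Definition top_finitely_generated (G : topologicalGroupType) : Prop :=
  exists S : set G, finite_set S /\ top_generates S.

Definition profinite (G : topologicalGroupType) : Prop :=
  [/\ compact [set: G], hausdorff_space G & totally_disconnected [set: G]].

Definition pro_p (p : nat) (G : topologicalGroupType) : Prop :=
  profinite G /\
  forall N : set G, is_subgroup N -> is_normal N -> open N ->
    exists k, (coset_space [set: G] N #= `I_(p ^ k))%card.

(* [B] is a bound for [log_p |gamma_n / gamma_n.+1|] over all [n >= 1]. *)
Definition finite_width (p : nat) (G : topologicalGroupType) : Prop :=
  infinite_set [set: G] /\
  exists B : nat, forall n, (0 < n)%N ->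
    (coset_space (lower_central G n) (lower_central G n.+1)
      #<= `I_(p ^ B))%card.

(* Main.v *)
Require Import Defs.
From mathcomp Require Import all_boot all_order all_algebra.
From mathcomp Require Import all_classical.
From mathcomp Require Import topology.
From mathcomp Require Import finfield ring zify.

(** Filter [R(K)] by the depth of a series. For [g = x + x^(m+1)] and
    [z = x + b x^(n+1)] the commutator of [g] and [z] is
    [x + (n-m) b x^(m+n+1) + ...], and that of [(1, g)] and [(1 + b x^n, x)] is
    [(1 + n b x^(m+n) + ..., x)].

    In characteristic [p], commutators with [H^e x| N^(e+1)] thus lie in
    [H^(e+1) x| N^(e+2)], and one step deeper still when [p] divides [e].
    Commutators with the two fixed elements [(1, x + x^2)] and [(1, x + x^3)]
    fill what remains. By compactness exact solutions follow from approximate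
    ones, so that the abstract lower central series is squeezed between two
    shifts of an explicit filtration. For [p = 2] the coefficients of odd index
    of [g] vanish faster than those of even index. They are recorded by the
    square root [D g] of [g'], and [g |-> (D g, g)] embeds [N(F_q)] in
    [R(F_q)], where [D g] has the expected depth.

    For finite generation of [N(Z)], a subgroup dense modulo depth [d] is dense
    modulo depth [d + 1] as soon as some product of commutators is
    [x + x^(d+1) + ...]. For even [d] the leading terms of commutators are even;
    odd ones come from the second-order term of a product of two commutators
    whose leading terms cancel. Finally [(1 + x)(g) / (1 + x)] with
    [g = x + x^n + ...] is [1 + x^n + ...], which yields [H(Z)]. *)

Set Implicit Arguments.
Unset Strict Implicit.
Unset Printing Implicit Defensive.

Import GRing.Theory.
Local Open Scope classical_set_scope.
Local Open Scope ring_scope.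

(** * Power series *)

Section PowerSeries.
Variable K : comPzRingType.
Implicit Types (f g h q s t : fps K) (b c : K).
Notation X := (fpsX K).

Definition fpsC b : fps K := FPS (fun n => b *+ (n == 0)%N).

Lemma fpsXM0E f : (X * f) 0%N = 0.
Proof. by rewrite fpsM0E /= mul0r. Qed.

Lemma fpsXMSE f n : (X * f) n.+1 = f n.
Proof.
rewrite fpsME big_ord_recl mul0r add0r big_ord_recl mul1r subSS subn0.
by rewrite big1 ?addr0 // => i _; rewrite mul0r.
Qed.

Lemma fpsXnME n f k : (X ^+ n * f) k = if (k < n)%N then 0 else f (k - n)%N.
Proof.
elim: n k => [|n IH] k; first by rewrite expr0 mul1r subn0.
rewrite exprS -mulrA; case: k => [|k]; first by rewrite fpsXM0E.
by rewrite fpsXMSE IH.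
Qed.

Lemma fpsCME b f k : (fpsC b * f) k = b * f k.
Proof.
rewrite fpsME big_ord_recl /= mulr1n subn0 big1 ?addr0 // => i _.
by rewrite mulr0n mul0r.
Qed.

Lemma fpsCD b c : fpsC (b + c) = fpsC b + fpsC c.
Proof. by apply/fpsP => n; rewrite fpsDE /= mulrnDl. Qed.
Lemma fpsCN b : fpsC (- b) = - fpsC b.
Proof. by apply/fpsP => n; rewrite /= mulNrn. Qed.
Lemma fpsCM b c : fpsC (b * c) = fpsC b * fpsC c.
Proof. by apply/fpsP => n; rewrite fpsCME /= mulrnAr. Qed.
Lemma fpsC1 : fpsC 1 = 1.
Proof. by apply/fpsP => n; rewrite fps1E. Qed.
Lemma fpsC0 : fpsC 0 = 0.
Proof. by apply/fpsP => n; rewrite /= mul0rn. Qed.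
Lemma fpsC_nat n : fpsC n%:R = n%:R.
Proof.
by elim: n => [|n IH]; rewrite ?fpsC0 // !mulrSr fpsCD IH fpsC1.
Qed.

Lemma fps_split f : f = fpsC (f 0%N) + X * FPS (fun n => f n.+1).
Proof.
by apply/fpsP => -[|n]; rewrite fpsDE ?fpsXM0E ?fpsXMSE /= ?addr0 ?add0r.
Qed.

(** Turns a congruence into an identity with a remainder [q], which [ring] can then verify. *)
Lemma fps_eqmodE n f g : fps_eqmod n f g <-> exists q, f = g + X ^+ n * q.
Proof.
split=> [fg|[q ->] i i_n]; last by rewrite fpsDE fpsXnME i_n addr0.
exists (FPS (fun i => f (n + i)%N - g (n + i)%N)); apply/fpsP => i.
rewrite fpsDE fpsXnME; case: ltnP => [/fg ->|n_i]; first by rewrite addr0.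
by rewrite /= subnKC // subrKC.
Qed.

Lemma fps_eqmodI n f q : fps_eqmod n (f + X ^+ n * q) f.
Proof. by apply/fps_eqmodE; exists q. Qed.

Lemma fps_eqmod_sym n f g : fps_eqmod n f g -> fps_eqmod n g f.
Proof. by move=> fg i /fg. Qed.

Lemma fps_eqmod_trans n f g h :
  fps_eqmod n f g -> fps_eqmod n g h -> fps_eqmod n f h.
Proof. by move=> fg gh i i_n; rewrite fg ?gh. Qed.

Lemma fps_eqmod_le m n f g : (m <= n)%N -> fps_eqmod n f g -> fps_eqmod m f g.
Proof. by move=> mn fg i im; apply: fg; apply: leq_trans mn. Qed.

Lemma fps_eqmod_next n f g :
  fps_eqmod n f g -> f n = g n -> fps_eqmod n.+1 f g.
Proof.
by move=> fg fgn i; rewrite ltnS leq_eqVlt => /predU1P[->|/fg].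
Qed.

Lemma fps_compD f g h : fps_comp (f + g) h = fps_comp f h + fps_comp g h.
Proof.
apply/fpsP => n; rewrite fpsDE -big_split.
by apply: eq_bigr => i _; rewrite fpsDE mulrDl.
Qed.

Lemma fps_compC b g : fps_comp (fpsC b) g = fpsC b.
Proof.
apply/fpsP => n; rewrite /= big_ord_recl expr0 mulr1n big1 ?addr0.
  by rewrite fps1E mulr_natr.
by move=> i _; rewrite mulr0n mul0r.
Qed.

Lemma fps_comp_id_mod n f g : fps_eqmod n g X -> fps_eqmod n (fps_comp f g) f.
Proof. by move=> gX; rewrite -[X in fps_eqmod _ _ X]fps_compX;
  apply: fps_eqmod_comp. Qed.

End PowerSeries.

Lemma expr1D_sqr (R : comPzRingType) (y : R) n :
  exists q, (1 + y) ^+ n = 1 + n%:R * y + y ^+ 2 * q.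
Proof.
elim: n => [|n [q IH]]; first by exists 0; rewrite expr0; ring.
by exists (n%:R + q + y * q); rewrite exprS IH -natr1; ring.
Qed.

Lemma expr1D_cube (R : comPzRingType) (y : R) n :
  exists q, (1 + y) ^+ n = 1 + n%:R * y + 'C(n, 2)%:R * y ^+ 2 + y ^+ 3 * q.
Proof.
elim: n => [|n [q IH]]; first by exists 0; rewrite expr0 bin_small //; ring.
exists ('C(n, 2)%:R + q + y * q); rewrite exprS IH binS bin1 natrD -natr1.
by ring.
Qed.

(** * Elements with prescribed leading terms *)

Section Series.
Variable K : comPzRingType.
Implicit Types (f q s t : fps K) (b : K) (g z : nottingham K) (h : useries K).
Notation X := (fpsX K).

(** [insubd] avoids carrying a membership proof, here and in [us_add]; for [0 < n] the series lies
    in the group and the default never occurs. *)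
Definition nt_add n s : nottingham K := insubd (nt_one K) (X + X ^+ n.+1 * s).
Definition us_add n s : useries K := insubd (us_one K) (1 + X ^+ n * s).

Lemma nt_addE n s : (0 < n)%N -> nt_val (nt_add n s) = X + X ^+ n.+1 * s.
Proof.
case: n => // n _; apply: (@insubdK _ _ (nottingham K)); rewrite unfold_in.
by rewrite !fpsDE !fpsXnME /= !addr0 !eqxx.
Qed.

Lemma us_addE n s : (0 < n)%N -> us_val (us_add n s) = 1 + X ^+ n * s.
Proof.
case: n => // n _; apply: (@insubdK _ _ (useries K)); rewrite unfold_in.
by rewrite fpsDE fpsXnME /= addr0 eqxx.
Qed.

Lemma nt_mulE g z : nt_val (g * z)%g = fps_comp (nt_val z) (nt_val g).
Proof. by []. Qed.
Lemma nt_oneE : nt_val (1%g : nottingham K) = X.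
Proof. by []. Qed.
Lemma us_mulE (h k : useries K) : us_val (h * k)%g = us_val h * us_val k.
Proof. by []. Qed.
Lemma us_oneE : us_val (1%g : useries K) = 1.
Proof. by []. Qed.

Lemma nt_eqmod1P n g :
  nt_eqmod n g 1%g -> exists s, nt_val g = X + X ^+ n.+1 * s.
Proof. by move/fps_eqmodE. Qed.

Lemma nt_splitP g : exists t, nt_val g = X + X ^+ 2 * t.
Proof.
apply: (@nt_eqmod1P 1) => -[|[|i]] // _.
  by rewrite !nottingham0.
by rewrite !nottingham1.
Qed.

Lemma nt_comp_addE n s g : (0 < n)%N ->
  fps_comp (nt_val (nt_add n s)) (nt_val g) =
  nt_val g + nt_val g ^+ n.+1 * fps_comp s (nt_val g).
Proof.
move=> n0; have g0 := nottingham0 g.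
by rewrite nt_addE // fps_compD fps_compM // fps_compXn // fps_compXl.
Qed.

(** First-order expansion of both substitutions: [z(g)] contributes [(e + 1) s t x^(e+2)] and [g(z)]
    contributes [2 s t x^(e+2)], whence the factor [e - 1]. *)
Lemma nt_mul_comm_mod g z e s t : (0 < e)%N ->
  nt_val g = X + X ^+ 2 * t -> nt_val z = X + X ^+ e.+1 * s ->
  exists q, nt_val (g * z)%g =
    nt_val (z * g)%g + X ^+ e.+2 * ((e%:R - 1) * s * t) + X ^+ e.+3 * q.
Proof.
move=> e0 gE zE; rewrite !nt_mulE.
have g0 := nottingham0 g; have z0 := nottingham0 z.
rewrite {1}zE {2}gE !fps_compD !fps_compM // !fps_compXn // !fps_compXl //.
have /fps_eqmodE[q1 ->] : fps_eqmod 2 (fps_comp s (nt_val g)) s.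
  by apply: fps_comp_id_mod; rewrite gE; apply: fps_eqmodI.
have /fps_eqmodE[q2 ->] : fps_eqmod e.+1 (fps_comp t (nt_val z)) t.
  by apply: fps_comp_id_mod; rewrite zE; apply: fps_eqmodI.
case: e e0 zE => // e _ zE; set E := X ^+ e.
have [q3 q3E] := expr1D_sqr (X * t) e.+2.
have -> : nt_val g ^+ e.+2 = X ^+ 2 * E * (1 + X * t) ^+ e.+2.
  rewrite /E -exprD -exprMn gE; congr (_ ^+ _); ring.
rewrite q3E gE zE !exprS expr0 -/E.
exists ((e.+2)%:R * t * X * q1 + t ^+ 2 * q3 * s + t ^+ 2 * q3 * X ^+ 2 * q1 +
  q1
   - (2 * s * X * E * q2 + q2 + E * s ^+ 2 * t + X ^+ 2 * E * E * s ^+ 2 * q2)).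
by ring.
Qed.

End Series.

(** * Congruences and commutators *)

Section Congruences.
Local Open Scope group_scope.
Variable G : groupType.
Implicit Types (g h x y z c : G).

Definition cm g h : G := g * h * g^-1 * h^-1.

Record congruence (R : G -> G -> Prop) : Prop := Congruence {
  cg_refl : forall x, R x x;
  cg_sym : forall x y, R x y -> R y x;
  cg_trans : forall x y z, R x y -> R y z -> R x z;
  cg_mul : forall x x' y y', R x x' -> R y y' -> R (x * y) (x' * y') }.

Lemma cm_mul g h : cm g h * (h * g) = g * h.
Proof. by rewrite /cm mulgA !mulgVK. Qed.

Lemma cmM g y z : cm g (y * z) = cm g y * (y * cm g z * y^-1).
Proof. by rewrite /cm invgM !mulgA !mulgVK. Qed.

Section Theory.
Variables (R : G -> G -> Prop) (RP : congruence R).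

Lemma cg_mull x y z : R y z -> R (x * y) (x * z).
Proof. by move=> yz; apply: (cg_mul RP) => //; apply: (cg_refl RP). Qed.

Lemma cg_mulr x y z : R y z -> R (y * x) (z * x).
Proof. by move=> yz; apply: (cg_mul RP) => //; apply: (cg_refl RP). Qed.

Lemma cg_inv x y : R x y -> R x^-1 y^-1.
Proof.
move=> xy; apply: (cg_sym RP).
have := cg_mulr y^-1 (cg_mull x^-1 xy).
by rewrite mulVg mul1g mulgK.
Qed.

Lemma cg_cm x x' y y' : R x x' -> R y y' -> R (cm x y) (cm x' y').
Proof.
move=> xx' yy'; rewrite /cm.
apply: (cg_mul RP); last exact: cg_inv.
apply: (cg_mul RP); last exact: cg_inv.
exact: (cg_mul RP).
Qed.

(** Comparing [c * (h * g)] with [g * h] means that inverse series never have to be expanded. *)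
Lemma cg_cm_eq g h c : R (c * (h * g)) (g * h) -> R (cm g h) c.
Proof.
move=> cE; apply: (cg_sym RP).
by have := cg_mulr (h * g)^-1 cE; rewrite mulgK invgM mulgA.
Qed.

Lemma cg_cm1 g h : R (g * h) (h * g) -> R (cm g h) 1.
Proof. by move=> gh; apply: cg_cm_eq; rewrite mul1g; apply: (cg_sym RP). Qed.

Lemma cg_ldiv x y : R x y <-> R (y^-1 * x) 1.
Proof.
split=> [xy|yx]; first by have := cg_mull y^-1 xy; rewrite mulVg.
by have := cg_mull y yx; rewrite mulgA mulgV mul1g mulg1.
Qed.

Lemma cg_subgroup : is_subgroup [set x | R x 1]%classic.
Proof. by apply: congr1_subgroup; case: RP. Qed.

End Theory.
End Congruences.

(** * Congruences on the Riordan group and expansions of commutators *)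

Section Riordan.
Variable K : comPzRingType.
Implicit Types (q t u : fps K) (g z : nottingham K) (h k : useries K).
Implicit Types (r : riordan K).
Notation X := (fpsX K).

Definition nt_cong n g z := fps_eqmod n (nt_val g) (nt_val z).
Definition us_cong n h k := fps_eqmod n (us_val h) (us_val k).
Definition rd_cong a b r r' :=
  us_cong a (rd_h r) (rd_h r') /\ nt_cong b (rd_g r) (rd_g r').

Lemma nt_cong_congr n : congruence (nt_cong n).
Proof.
split=> [//|x y|x y z|x x' y y' xx yy].
- exact: fps_eqmod_sym.
- exact: fps_eqmod_trans.
- exact: fps_eqmod_comp.
Qed.

Lemma us_cong_congr n : congruence (us_cong n).
Proof.
split=> [//|x y|x y z|x x' y y' xx yy].
- exact: fps_eqmod_sym.
- exact: fps_eqmod_trans.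
- exact: fps_eqmodM.
Qed.

(** The first component of a product involves a substitution [k(g)], which is controlled modulo
    [X^a] once [g] is; hence [a <= b]. *)
Lemma rd_cong_congr a b : (a <= b)%N -> congruence (rd_cong a b).
Proof.
move=> ab; split=> [//|x y [xh xg]|x y z [xh xg] [yh yg]|].
- by split; apply: fps_eqmod_sym.
- by split; [apply: fps_eqmod_trans xh yh|apply: fps_eqmod_trans xg yg].
move=> x x' y y' [xh xg] [yh yg]; split; last exact: fps_eqmod_comp.
by apply: fps_eqmodM => //; apply: fps_eqmod_comp => //; apply: fps_eqmod_le xg.
Qed.

Lemma rd_cong_le a b a' b' r r' : (a' <= a)%N -> (b' <= b)%N ->
  rd_cong a b r r' -> rd_cong a' b' r r'.
Proof.
by move=> aa bb [? ?]; split;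
  [apply: fps_eqmod_le aa _|apply: fps_eqmod_le bb _].
Qed.

Lemma us_subst_mod (f : nat) u t g h :
  nt_val g = X + X ^+ 2 * t -> us_val h = 1 + X ^+ f * u ->
  exists q, us_val (us_subst g h) =
    us_val h + X ^+ f.+1 * (f%:R * t * u) + X ^+ f.+2 * q.
Proof.
move=> gE hE; rewrite /= hE.
have g0 := nottingham0 g.
rewrite fps_compD fps_comp1 fps_compM // fps_compXn // fps_compXl //.
have /fps_eqmodE[q1 ->] : fps_eqmod 2 (fps_comp u (nt_val g)) u.
  by apply: fps_comp_id_mod; rewrite gE; apply: fps_eqmodI.
have [q3 q3E] := expr1D_sqr (X * t) f; set E := X ^+ f.
have -> : nt_val g ^+ f = E * (1 + X * t) ^+ f.
  by rewrite /E -exprMn gE; congr (_ ^+ _); ring.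
rewrite q3E !exprS expr0 -/E.
exists ((1 + f%:R * (X * t) + X ^+ 2 * t ^+ 2 * q3) * q1 + t ^+ 2 * q3 * u).
by ring.
Qed.

(* The jump by two when [e] vanishes in [K] is what makes the lower central
   series deepen faster than one step at a time. *)
Lemma rd_cong_comm e d r s :
  (d = 1%N) \/ (d = 2%N /\ e%:R = 0 :> K) ->
  rd_cong e e.+2 s 1%g -> rd_cong (e + d) (e + d).+2 (r * s)%g (s * r)%g.
Proof.
case: r s => [h g] [k z] dE [/= /fps_eqmodE[u kE] /fps_eqmodE[v zE]].
have [t gE] := nt_splitP g.
split=> /=; last first.
  have [q] := nt_mul_comm_mod (ltn0Sn e) gE zE.
  have -> : e.+1%:R - 1 = e%:R :> fps K by rewrite -natr1 addrK.
  rewrite /nt_cong => ->; case: dE => [->|[-> e0]].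
    rewrite addn1; apply/fps_eqmodE; exists (e%:R * v * t + X * q).
    by rewrite !exprS; ring.
  rewrite addn2 -fpsC_nat e0 fpsC0 mul0r mul0r mulr0 addr0.
  exact: fps_eqmodI.
have [q kgE] := us_subst_mod gE kE.
have kg : fps_eqmod (e + d) (fps_comp (us_val k) (nt_val g)) (us_val k).
  move: kgE => /= ->; case: dE => [->|[-> e0]].
    rewrite addn1; apply/fps_eqmodE; exists (e%:R * t * u + X * q).
    by rewrite !exprS; ring.
  rewrite addn2 -fpsC_nat e0 fpsC0 mul0r mul0r mulr0 addr0.
  exact: fps_eqmodI.
have hz : fps_eqmod (e + d) (fps_comp (us_val h) (nt_val z)) (us_val h).
  apply: fps_comp_id_mod; rewrite zE; apply: fps_eqmod_le (@fps_eqmodI _ _ _ _).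
  by case: dE => [->|[->]]; rewrite ?addn1 ?addn2.
apply: fps_eqmod_trans (fps_eqmodM (fun _ _ => erefl) kg) _.
rewrite mulrC; apply: fps_eqmodM => //.
exact: fps_eqmod_sym.
Qed.

(** Here [h(x + x^(m+1)) = 1 + b x^n (1 + x^m)^n], whose first new term is [n b x^(n+m)]. By [cm_us]
    below the left-hand side is a commutator. *)
Lemma us_comm_mod n m (b : K) : (0 < n)%N -> (0 < m)%N ->
  us_cong (n + m).+1
    (us_subst (nt_add m 1%R) (us_add n (fpsC b)) * (us_add n (fpsC b))^-1)%g
    (us_add (n + m) (fpsC (n%:R * b))).
Proof.
move=> n0 m0; set h := us_add n _; set g := nt_add m _; set w := us_add _ _.
suff: us_cong (n + m).+1 (us_subst g h) (w * h)%g.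
  by move=> /(cg_mulr (us_cong_congr _) (h^-1)%g); rewrite mulgK.
have g0 := nottingham0 g.
rewrite /us_cong us_mulE [us_val (us_subst g h)]/= !us_addE //; last first.
  by rewrite addn_gt0 n0.
rewrite fps_compD fps_comp1 fps_compM // fps_compXn // fps_compXl // fps_compC.
rewrite nt_addE //.
have -> : (X + X ^+ m.+1 * 1) ^+ n = X ^+ n * (1 + X ^+ m) ^+ n.
  by rewrite -exprMn exprS; congr (_ ^+ _); ring.
have [q ->] := expr1D_sqr (X ^+ m) n.
rewrite exprS exprD fpsCM fpsC_nat.
apply/fps_eqmodE; case: n n0 @h @w => // n _ h w;
  case: m m0 @g g0 @w => // m _ g g0 w.
exists (X ^+ m * q * fpsC b - X ^+ n * n.+1%:R * fpsC b ^+ 2).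
by rewrite !exprS exprD !exprS; ring.
Qed.

(** The term of index [n + 2m + 1] is kept because it is what survives in [lead_comm2], where the
    leading terms cancel. *)
Lemma nt_comm_mod m n (b : K) : (0 < m < n)%N ->
  nt_cong (n + m.*2).+2 (cm (nt_add m 1%R) (nt_add n (fpsC b)))
    (nt_add (m + n) (fpsC (b * (n%:R - m%:R)) + X ^+ m *
      fpsC (b * ('C(n.+1, 2)%:R - m.+1%:R * (n%:R - m%:R))))).
Proof.
move=> /andP[m0 mn]; have n0 : (0 < n)%N by apply: leq_trans mn.
apply: (cg_cm_eq (@nt_cong_congr _)).
set g := nt_add m 1%R; set z := nt_add n _; set c := nt_add _ _.
have mn0 : (0 < m + n)%N by rewrite addn_gt0 m0.
have PcE : nt_val (c * (z * g))%g = nt_val (c * z)%g + nt_val (c * z)%g ^+ m.+1.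
  by rewrite mulgA [LHS]nt_mulE nt_comp_addE // fps_comp1 mulr1.
have czE : nt_val (c * z)%g = nt_val c + nt_val c ^+ n.+1 * fpsC b.
  by rewrite nt_mulE nt_comp_addE // fps_compC.
have gzE : nt_val (g * z)%g = nt_val g + nt_val g ^+ n.+1 * fpsC b.
  by rewrite nt_mulE nt_comp_addE // fps_compC.
rewrite /nt_cong PcE czE gzE /c /g !nt_addE //.
have [j nE] : exists j : nat, n = (m + j).+1 by exists (n - m.+1)%N; lia.
have [i mE] : exists i : nat, m = i.+1 by exists m.-1; lia.
set w := fpsC _ + _.
set M := X ^+ m; set N := X ^+ n; set B := fpsC b.
have [q1 q1E] := expr1D_sqr (M * N * w) n.+1.
have [q2 q2E] := expr1D_sqr (N * (B + M * w + M * N * B * (n.+1%:R * w + M * N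
  * w^+2 * q1))) m.+1.
have [q3 q3E] := expr1D_cube M n.+1.
have -> : (X + X ^+ (m + n).+1 * w) ^+ n.+1 =
    X * N * (1 + n.+1%:R * (M * N * w) + (M * N * w) ^+ 2 * q1).
  rewrite -q1E /N -exprS -exprMn; congr (_ ^+ _).
  by rewrite exprS exprD -/M -/N; ring.
have -> : (X + X ^+ m.+1 * 1) ^+ n.+1 =
    X * N * (1 + n.+1%:R * M + 'C(n.+1, 2)%:R * M ^+ 2 + M ^+ 3 * q3).
  by rewrite -q3E /N -exprS -exprMn; congr (_ ^+ _); rewrite exprS -/M; ring.
set y := (X in X ^+ m.+1).
have -> : y ^+ m.+1 = X * M * (1 + m.+1%:R * (N * (B + M * w + M * N * B *
    (n.+1%:R * w + M * N * w ^+ 2 * q1))) + (N * (B + M * w + M * N * B *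
    (n.+1%:R * w + M * N * w ^+ 2 * q1))) ^+ 2 * q2).
  rewrite -q2E /M -exprS -exprMn; congr (_ ^+ _).
  by rewrite /y exprS exprD -/M -/N; ring.
rewrite /y {y q1E q2E q3E} -mul2n mulnC muln2 -addnn.
have -> : X ^+ (m + n).+1 = X * M * N by rewrite exprS exprD -/M -/N; ring.
have -> : X ^+ m.+1 = X * M by rewrite exprS.
apply/fps_eqmodE.
have -> : X ^+ (n + (m + m)).+2 = X ^+ 2 * N * M ^+ 2.
  by rewrite !exprS !exprD -/M -/N; ring.
(* Since [m < n], one factor [N] absorbs [X M]. Together with [M = X X^i] this pushes every
   remaining term into the multiples of [X^2 N M^2]. *)
have NE : N = X * M * X ^+ j by rewrite /N nE exprS exprD -/M; ring.
have ME : M = X * X ^+ i by rewrite /M mE exprS.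
move: NE ME; set N' := X ^+ j; set M' := X ^+ i => NE ME.
set A := B * (n%:R - m%:R).
set D := B * ('C(n.+1, 2)%:R - m.+1%:R * (n%:R - m%:R)).
have -> : w = A + M * D.
  by rewrite /w !fpsCM !fpsCD !fpsCN !fpsCM !fpsCD !fpsCN !fpsC_nat.
clear -ME NE; clearbody B M' N' M N.
set s := n.+1%:R * _ + _ * q1; set v := _ + M * N * B * s.
set q := M' * (m.+1%:R * D - q3 * B) + N' * (B * s + v ^+ 2 * q2)
  + m.+1%:R * M * N' * B * s.
exists q.
have -> : X ^+ 2 * N * M ^+ 2 * q =
    X * (M ^+ 2 * N * (X * M') * (m.+1%:R * D - q3 * B)
    + M * N * (X * M * N') * (B * s + v ^+ 2 * q2)
    + m.+1%:R * M ^+ 2 * N * (X * M * N') * B * s) by rewrite /q; ring.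
rewrite -ME -NE /v /s /D /A.
by ring.
Qed.
End Riordan.

(** * Topology *)

Section InverseLimit.
Local Open Scope group_scope.
Variables (G : groupType) (F : nat -> set G).
Hypothesis F_subgroup : forall n, is_subgroup (F n).
Hypothesis F_decr : forall m n, (m <= n)%N -> F n `<=` F m.

Lemma invlim_nbhsP (x : invlim_topology F) (A : set (invlim_topology F)) :
  nbhs x A <-> exists n, [set y : G | F n ((x : G)^-1 * y)] `<=` A.
Proof.
split=> [|[n nA]]; last first.
  by apply: filterS nA _; exact: (invlim_nbhs_coset F_subgroup n x).
(* The cosets form a filter base because [F] decreases. Their filter converges to [x], hence
   contains every neighbourhood of [x]. *)
pose E : set_system (invlim_topology F) :=
  filter_from [set: nat] (fun n => [set y : G | F n ((x : G)^-1 * y)]).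
have FE : Filter E.
  apply: filter_from_filter; first by exists 0%N.
  move=> i j _ _; exists (maxn i j) => // y /= Fy.
  by split; apply: F_decr Fy; rewrite ?leq_maxl ?leq_maxr.
have /(_ A) : E --> x.
  apply/invlim_cvg => n; exists n => // y /= xy.
  exact/left_cosetP.
by move=> + /[dup] xA => /(_ xA) [n _ nA]; exists n.
Qed.

End InverseLimit.

Section Topology.
Variable K : comPzRingType.

(** [nt_filt n] is congruence to the identity modulo [X^(n+1)]; the existential over [n] absorbs
    this shift. *)
Lemma nt_nbhsP (x : nottingham K) (A : set (nottingham K)) :
  nbhs x A <-> exists n, forall y, nt_cong n y x -> A y.
Proof.
have decr m n : (m <= n)%N -> @nt_filt K n `<=` @nt_filt K m.
  by move=> mn g gn i /andP[i1 im]; apply: gn; rewrite i1 (leq_trans im).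
apply: iff_trans (invlim_nbhsP (@nt_filt_subgroup K) decr x A) _.
split=> -[n nA].
  exists n.+1 => y /(cg_ldiv (nt_cong_congr K _)) yx; apply: nA.
  by rewrite /= nt_filtE.
exists n => y; rewrite /= nt_filtE => /(proj2 (cg_ldiv (nt_cong_congr K n.+1) y
  x)) yx.
by apply: nA; apply: fps_eqmod_le yx.
Qed.

Lemma rd_nbhsP (x : riordan K) (A : set (riordan K)) :
  nbhs x A <-> exists n, forall y, rd_cong n n y x -> A y.
Proof.
have decr m n : (m <= n)%N -> @rd_filt K n `<=` @rd_filt K m.
  move=> mn r [rh rg]; split=> i /andP[i1 im].
    by apply: rh; rewrite i1 (leq_trans im).
  by apply: rg; rewrite i1 (leq_trans im).
have E n : congruence (@rd_cong K n n.+1) by apply: rd_cong_congr.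
apply: iff_trans (invlim_nbhsP (@rd_filt_subgroup K) decr x A) _.
split=> -[n nA].
  exists n.+1 => y /(rd_cong_le (leqnSn n) (leqnn n.+1)) /(cg_ldiv (E n)) yx.
  by apply: nA; rewrite /= rd_filtE.
exists n => y; rewrite /= rd_filtE => /(proj2 (cg_ldiv (E n) y x)) yx.
by apply: nA; apply: rd_cong_le yx.
Qed.

Lemma nt_denseP (D : set (nottingham K)) :
  dense D <-> forall x n, exists2 y, D y & nt_cong n y x.
Proof.
split=> [Dd x n|DP O [x Ox] Oop].
  have : nbhs x [set y | nt_cong n y x] by apply/nt_nbhsP; exists n.
  rewrite nbhsE => -[B [Bop Bx] BS].
  by have [y [/BS yx Dy]] := Dd B (ex_intro _ x Bx) Bop; exists y.
have /nt_nbhsP[n nO] : nbhs x O by apply: open_nbhs_nbhs.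
by have [y Dy yx] := DP x n; exists y; split=> //; apply: nO.
Qed.

Lemma rd_denseP (D : set (riordan K)) :
  dense D <-> forall x n, exists2 y, D y & rd_cong n n y x.
Proof.
split=> [Dd x n|DP O [x Ox] Oop].
  have : nbhs x [set y | rd_cong n n y x] by apply/rd_nbhsP; exists n.
  rewrite nbhsE => -[B [Bop Bx] BS].
  by have [y [/BS yx Dy]] := Dd B (ex_intro _ x Bx) Bop; exists y.
have /rd_nbhsP[n nO] : nbhs x O by apply: open_nbhs_nbhs.
by have [y Dy yx] := DP x n; exists y; split=> //; apply: nO.
Qed.

Lemma rd_eqP (x y : riordan K) : (forall n, rd_cong n n x y) -> x = y.
Proof.
case: x y => [h g] [k z] xy; congr Riordan; apply/val_inj/fpsP => n.
  by have [+ _] := xy n.+1; apply.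
by have [_ +] := xy n.+1; apply.
Qed.

Lemma rd_cong_clopen (x : riordan K) n : clopen [set y | rd_cong n n y x].
Proof.
have RP := rd_cong_congr K (leqnn n).
have op (P : riordan K -> Prop) :
  (forall y z, rd_cong n n z y -> P y -> P z) -> open [set y | P y].
  move=> PE; rewrite openE => y Py; apply/rd_nbhsP; exists n => z zy.
  exact: PE zy Py.
split; first by apply: op => y z zy yx; apply: (cg_trans RP) zy yx.
rewrite -openC; apply: op => y z zy yx zx; apply: yx.
exact: (cg_trans RP) (cg_sym RP zy) zx.
Qed.

Lemma riordan_zero_dimensional : zero_dimensional (riordan K).
Proof.
move=> x y xy; have /existsNP[n xyn] : ~ forall n, rd_cong n n x y.
  by move=> /rd_eqP; apply/eqP.
exists [set z | rd_cong n n z x]; split.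
- exact: rd_cong_clopen.
- exact: (cg_refl (rd_cong_congr K (leqnn n))).
- by move=> /(cg_sym (rd_cong_congr K (leqnn n))).
Qed.

Lemma riordan_hausdorff : hausdorff_space (riordan K).
Proof.
move=> x y xy; apply: rd_eqP => n; have RP := rd_cong_congr K (leqnn n).
have nb (z : riordan K) : nbhs z [set w | rd_cong n n w z].
  by apply/rd_nbhsP; exists n.
have [z [zx zy]] := xy _ _ (nb x) (nb y).
exact: (cg_trans RP) (cg_sym RP zx) zy.
Qed.

End Topology.

(** * Compactness and profiniteness *)

Section Compact.
Variable K : finComPzRingType.

(** By Tychonoff: the group is the image, under the continuous map [phi], of a countable power of
    the finite discrete space [K * K] of pairs of free coefficients. *)
Lemma riordan_compact : compact [set: riordan K].
Proof.
pose T := prod_topology (fun _ : nat => discrete_topology (K * K)%type).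
pose phi (u : T) : riordan K :=
  Riordan (us_add 1 (FPS (fun n => (u n).1))) (nt_add 1 (FPS (fun n => (u
    n).2))).
have phi_cont : continuous phi.
  move=> u A /rd_nbhsP[n nA].
  have un : nbhs u [set v : T | forall i, (i < n)%N -> v i = u i].
    elim: n {nA} => [|n IH]; first by apply: filterE.
    have un : nbhs u [set v : T | v n = u n].
      have /cvg_sup/(_ n)/initial_cvg/discrete_cvg : nbhs u --> u by [].
      exact.
    apply: filterS2 IH un => v vu vn i.
    by rewrite ltnS leq_eqVlt => /predU1P[->|/vu].
  apply: filterS un => v vu; apply: nA.
  split=> i i_n.
    rewrite !us_addE // !fpsDE !expr1; case: i i_n => [|i] i_n.
      by rewrite !fpsXM0E.
    by rewrite !fpsXMSE /= vu // ltnW.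
  rewrite !nt_addE // !fpsDE !fpsXnME; case: ltnP => // i1 /=.
  by rewrite vu // (leq_ltn_trans (leq_subr _ _)).
have <- : phi @` [set: T] = [set: riordan K].
  apply/seteqP; split=> // r _.
  exists (fun n => (us_val (rd_h r) n.+1, nt_val (rd_g r) n.+2)) => //.
  case: r => h g; congr Riordan; apply/val_inj/fpsP => -[|n] /=.
  - by rewrite us_addE // fpsDE expr1 fpsXM0E addr0 useriesP.
  - by rewrite us_addE // fpsDE expr1 fpsXMSE add0r.
  - by rewrite !nottingham0.
  - rewrite nt_addE // fpsDE fpsXnME.
    by case: n => [|n] /=; rewrite ?addr0 ?nottingham1 // add0r subn2.
apply: continuous_compact; first exact: continuous_subspaceT.
have -> : [set: T] = [set u | forall i, [set: K * K] (u i)] by apply/seteqP;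
  split.
have fin (i : nat) : compact [set: discrete_topology (K * K)%type].
  exact/finite_compact/(@finite_finset (K * K)%type).
exact: (@tychonoff nat (fun=> discrete_topology (K * K)%type) (fun=> setT) fin).
Qed.

Lemma riordan_profinite : profinite (riordan K).
Proof.
split; [exact: riordan_compact|exact: riordan_hausdorff|].
exact/zero_dimension_totally_disconnected/riordan_zero_dimensional.
Qed.

End Compact.

(** * Topological generation *)

Section GeneratedSubgroup.
Local Open Scope group_scope.
Variable G : groupType.
Implicit Types (S H : set G) (x y : G).

Lemma gen_subgroup_subgroup S : is_subgroup (gen_subgroup S).
Proof.
split=> [H [[] ]//|x y Sx Sy H HS|x Sx H HS].
  by have [[_ HM _] _] := HS; apply: HM; [apply: Sx|apply: Sy].
by have [[_ _ HV] _] := HS; apply: HV; apply: Sx.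
Qed.

Lemma sub_gen_subgroup S : S `<=` gen_subgroup S.
Proof. by move=> x Sx H [_]; apply. Qed.

Lemma gen_subgroup_min S H : is_subgroup H -> S `<=` H -> gen_subgroup S `<=` H.
Proof. by move=> Hg SH x; apply. Qed.

Lemma subgroup_cm H x y : is_subgroup H -> H x -> H y -> H (cm x y).
Proof. by case=> _ HM HV Hx Hy;
  exact: (HM _ _ (HM _ _ (HM _ _ Hx Hy) (HV _ Hx)) (HV _ Hy)). Qed.

(** A factor trivial for [R] is central for [R'] and drops out of commutators. Approximating both
    entries thus approximates the commutator to a better precision. *)
Lemma cg_cm_central (R R' : G -> G -> Prop) :
  congruence R -> congruence R' ->
  (forall g u, R u 1 -> R' (g * u) (u * g)) ->
  forall x x' y y', R x x' -> R y y' -> R' (cm x y) (cm x' y').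
Proof.
move=> RP RP' RC.
have cml x x' y : R x x' -> R' (cm x y) (cm x' y).
  move=> /(proj1 (cg_ldiv RP x x')); set u := x'^-1 * x => u1.
  have -> : x = x' * u by rewrite /u mulVKg.
  clearbody u.
  apply: cg_cm_eq => //.
  apply: (cg_trans RP' (y := x' * y * u)); last first.
    by rewrite -!mulgA; apply: (cg_mull RP'); apply: RC.
  by rewrite /cm !mulgA !mulgVK; apply: (cg_refl RP').
have cmV x y : cm x y = (cm y x)^-1 by rewrite /cm !invgM !invgK !mulgA.
move=> x x' y y' xx' yy'.
apply: (cg_trans RP' (cml _ _ _ xx')).
rewrite (cmV x' y) (cmV x' y'); apply: (cg_inv RP').
exact: cml.
Qed.

End GeneratedSubgroup.

Lemma subr_closed_mulz (P : int -> Prop) a :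
  (forall x y, P x -> P y -> P (x - y)) -> P a -> forall z, P (z * a).
Proof.
move=> PB Pa; have P0 : P 0 by rewrite -(subrr a); apply: PB.
have PN x : P x -> P (- x) by move=> Px; rewrite -sub0r; apply: PB.
have Pn (n : nat) : P (n%:Z * a).
  elim: n => [|n IH]; first by rewrite mul0r.
  have -> : n.+1%:Z * a = n%:Z * a - - a by rewrite -addn1 PoszD; ring.
  by apply: PB => //; apply: PN.
by case=> n; rewrite ?NegzE ?mulNr; [|apply: PN]; apply: Pn.
Qed.

(** * Arithmetic of leading coefficients *)

Section LeadingTerms.
Variable K : comPzRingType.
Implicit Types (s t : fps K) (a b : K).
Notation X := (fpsX K).

Lemma us_addM n s t : (0 < n)%N ->
  us_cong n.*2 (us_add n s * us_add n t)%g (us_add n (s + t)).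
Proof.
move=> n0; rewrite /us_cong us_mulE !us_addE //; apply/fps_eqmodE;
  exists (s * t).
by rewrite -addnn exprD; ring.
Qed.

Lemma nt_addM n s t : (0 < n)%N ->
  nt_cong n.*2.+1 (nt_add n s * nt_add n t)%g (nt_add n (s + t)).
Proof.
move=> n0; rewrite /nt_cong nt_mulE nt_comp_addE // !nt_addE //.
have /fps_eqmodE[q ->] : fps_eqmod n.+1 (fps_comp t (X + X ^+ n.+1 * s)) t.
  by apply: fps_comp_id_mod; apply: fps_eqmodI.
have -> : (X + X ^+ n.+1 * s) ^+ n.+1 = X ^+ n.+1 * (1 + X ^+ n * s) ^+ n.+1.
  by rewrite -exprMn; congr (_ ^+ _); rewrite exprS; ring.
have [q1 ->] := expr1D_sqr (X ^+ n * s) n.+1; set E := X ^+ n in q1 *.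
apply/fps_eqmodE.
exists ((n.+1%:R * s + E * s ^+ 2 * q1) * (t + X * E * q) + X * q).
by rewrite -addnn !exprS exprD -/E; ring.
Qed.

Lemma nt_add_mod n k s t : (0 < n)%N -> (k <= n.+1)%N ->
  fps_eqmod k s t -> nt_cong (n.+1 + k) (nt_add n s) (nt_add n t).
Proof.
move=> n0 kn /fps_eqmodE[q ->]; rewrite /nt_cong !nt_addE //.
by apply/fps_eqmodE; exists q; rewrite exprD; ring.
Qed.

Lemma nt_comm_cong e (g z : nottingham K) : (0 < e)%N ->
  nt_cong e.+1 z 1%g -> nt_cong e.+2 (g * z)%g (z * g)%g.
Proof.
move=> e0 /fps_eqmodE[s zE]; have [t gE] := nt_splitP g.
have [q] := nt_mul_comm_mod e0 gE zE.
rewrite /nt_cong => ->; apply/fps_eqmodE; exists ((e%:R - 1) * s * t + X * q).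
by rewrite !exprS; ring.
Qed.

Lemma us_lead n (h : useries K) : us_cong n h 1%g -> (0 < n)%N ->
  us_cong n.+1 h (us_add n (fpsC (us_val h n))).
Proof.
move=> hn n0; apply: fps_eqmod_next.
  by apply: fps_eqmod_trans hn (fps_eqmod_sym _); rewrite us_addE //;
    apply: fps_eqmodI.
by rewrite us_addE // fpsDE fpsXnME ltnn subnn fps1E gtn_eqF // add0r.
Qed.

Lemma nt_lead n (g : nottingham K) : nt_cong n.+1 g 1%g -> (0 < n)%N ->
  nt_cong n.+2 g (nt_add n (fpsC (nt_val g n.+1))).
Proof.
move=> gn n0; apply: fps_eqmod_next.
  by apply: fps_eqmod_trans gn (fps_eqmod_sym _); rewrite nt_addE //;
    apply: fps_eqmodI.
rewrite nt_addE // fpsDE fpsXnME ltnn subnn /=.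
by case: n n0 {gn} => // n _; rewrite add0r.
Qed.

End LeadingTerms.

(** * Dense subgroups over rings whose elements are the images of integers *)

Section Generation.
Variable K : comPzRingType.
Hypothesis int_onto : forall a : K, exists z : int, a = z%:~R.
Notation X := (fpsX K).

Lemma riordan_top_generates (SN : set (nottingham K)) : top_generates SN ->
  top_generates ([set Riordan (us_1X K) 1%g] `|` [set Riordan 1%g g | g in SN]).
Proof.
set S := _ `|` _; move=> /nt_denseP SNd; apply/rd_denseP.
have [L1 LM LV] := gen_subgroup_subgroup S;
  set L := gen_subgroup S in L1 LM LV *.
have SL : S `<=` L by apply: sub_gen_subgroup.
have LN g : gen_subgroup SN g -> L (Riordan 1%g g).
  move: g; apply: (@gen_subgroup_min _ SN [set g | L (Riordan 1%g g)]);
    last first.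
    by move=> g Sg; apply: SL; right; exists g.
  split=> [|x y /= Lx Ly|x /= Lx] //.
    have -> : Riordan 1%g (x * y)%g = (Riordan 1%g x * Riordan 1%g y)%g.
      by congr Riordan; rewrite /= us_subst1 mulg1.
    exact: LM.
  have -> : Riordan 1%g (x^-1)%g = ((Riordan 1%g x)^-1)%g.
    by congr Riordan; rewrite /= invg1 us_subst1.
  exact: LV.
(* Conjugation by [(1, g)] acts on H as [h -> h(g)], so [LH] is a subgroup stable under substitution
   of elements of [gen_subgroup SN]. *)
pose LH := [set h | L (Riordan h 1%g)].
have LHM h k : LH h -> LH k -> LH (h * k)%g.
  rewrite /LH /= => Lh Lk.
  have -> : Riordan (h * k)%g 1%g = (Riordan h 1%g * Riordan k 1%g)%g.
    by congr Riordan; rewrite /= ?us_subst_id ?mulg1.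
  exact: LM.
have LHV h : LH h -> LH (h^-1)%g.
  rewrite /LH /= => Lh.
  have -> : Riordan (h^-1)%g 1%g = ((Riordan h 1%g)^-1)%g.
    by congr Riordan; rewrite /= ?invg1 ?us_subst_id.
  exact: LV.
have LHg g h : gen_subgroup SN g -> LH h -> LH (us_subst g h).
  rewrite /LH /= => /LN Lg Lh.
  have -> : Riordan (us_subst g h) 1%g =
      (Riordan 1%g g * Riordan h 1%g * (Riordan 1%g g)^-1)%g.
    by congr Riordan; rewrite /= ?invg1 ?us_subst1 ?mulg1 ?mul1g ?mulgV.
  exact: (LM _ _ (LM _ _ Lg Lh) (LV _ Lg)).
have LX : LH (us_1X K) := SL _ (or_introl erefl).
have lead1 n : exists2 h, LH h & us_cong n.+2 h (us_add n.+1 (fpsC 1)).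
  case: n => [|n].
    exists (us_1X K) => //; rewrite /us_cong us_addE //= fpsC1 expr1 mulr1.
    by move=> i _.
  (* With [g = x + x^(n+2)] up to higher terms, [(1 + g) / (1 + x)] is [1 + x^(n+2)] up to higher
     terms. *)
  have [g Lg gE] := SNd (nt_add n.+1 1) n.+3.
  exists (us_subst g (us_1X K) * (us_1X K)^-1)%g; first by apply: LHM;
    [apply: LHg|apply: LHV].
  set w := us_add _ _.
  suff: us_cong n.+3 (us_subst g (us_1X K)) (w * us_1X K)%g.
    by move=> /(cg_mulr (us_cong_congr K _) (us_1X K)^-1%g); rewrite mulgK.
  rewrite /us_cong us_mulE /w us_addE //= fps_compD fps_comp1 fps_compXl
    ?nottingham0 //.
  move: gE; rewrite /nt_cong nt_addE // => /fps_eqmodE[q ->].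
  by apply/fps_eqmodE; exists (q - 1); rewrite fpsC1 !exprS; ring.
(* The leading coefficients attained form an additive group containing 1, hence exhaust the image of
   the integers, which is [K]. *)
have lead n a : exists2 h, LH h & us_cong n.+2 h (us_add n.+1 (fpsC a)).
  have [z ->] := int_onto a.
  pose P (z : int) := exists2 h, LH h & us_cong n.+2 h (us_add n.+1 (fpsC
    z%:~R)).
  rewrite -(mulr1 z); apply: (@subr_closed_mulz P); last by have := lead1 n.
  move=> x y [h Lh hx] [k Lk ky]; exists (h * k^-1)%g;
    first by apply: LHM => //; apply: LHV.
  have RP := us_cong_congr K n.+2.
  suff: us_cong n.+2 h (us_add n.+1 (fpsC (x - y)%:~R) * k)%g.
    by move=> /(cg_mulr RP k^-1%g); rewrite mulgK.
  apply: (cg_trans RP hx).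
  apply: (cg_trans RP _ (cg_mull RP _ (cg_sym RP ky))).
  have -> : fpsC x%:~R = fpsC (x - y)%:~R + fpsC y%:~R :> fps K.
    by rewrite -fpsCD -intrD subrK.
  apply: (cg_sym RP); apply: fps_eqmod_le (us_addM _ _ (ltn0Sn n)).
  by rewrite doubleS !ltnS -addnn leq_addr.
have dense_h n h : exists2 h', LH h' & us_cong n h' h.
  elim: n h => [|[|n] IH] h; first by by exists 1%g.
    by exists 1%g => // -[] // _; rewrite !useriesP.
  have [h' Lh' hh'] := IH h; have RP m := us_cong_congr K m.
  have hn := us_lead (proj1 (cg_ldiv (RP _) _ _) (cg_sym (RP _) hh')) (ltn0Sn
    n).
  have [k Lk kE] := lead n (us_val (h'^-1 * h)%g n.+1).
  exists (h' * k)%g; first exact: LHM.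
  have := cg_trans (RP _) kE (cg_sym (RP _) hn).
  by move=> /(cg_mull (RP _) h'); rewrite mulVKg.
move=> [h g] n.
have [g' Lg' gg'] := SNd g n; have [h' Lh' hh'] := dense_h n h.
exists (Riordan h' 1%g * Riordan 1%g g')%g; first by apply: LM => //; apply: LN.
by split=> /=; rewrite ?us_subst1 ?mulg1 ?mul1g.
Qed.

Notation NN := (commg_subgroup [set: nottingham K] [set: nottingham K]).

(** Integer coefficients let one computation serve both [int] and ['F_p]. *)
Definition lead_comm d (a : int) :=
  exists2 c : nottingham K, NN c & nt_cong d.+2 c (nt_add d (fpsC a%:~R)).

Lemma NN_cm g z : NN (cm g z).
Proof. by apply: sub_gen_subgroup; exists g => //; exists z. Qed.

Lemma nt_add_cong_ldiv d (g z : nottingham K) (a b : int) : (0 < d)%N ->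
  nt_cong d.+2 g (nt_add d (fpsC a%:~R)) ->
  nt_cong d.+2 z (nt_add d (fpsC b%:~R)) ->
  nt_cong d.+2 (g * z^-1)%g (nt_add d (fpsC (a - b)%:~R)).
Proof.
move=> d0 ga zb; have RP := nt_cong_congr K d.+2.
suff: nt_cong d.+2 g (nt_add d (fpsC (a - b)%:~R) * z)%g.
  by move=> /(cg_mulr RP z^-1%g); rewrite mulgK.
apply: (cg_trans RP ga).
apply: (cg_trans RP _ (cg_mull RP _ (cg_sym RP zb))).
have -> : fpsC a%:~R = fpsC (a - b)%:~R + fpsC b%:~R :> fps K.
  by rewrite -fpsCD -intrD subrK.
apply: (cg_sym RP); apply: fps_eqmod_le (nt_addM _ _ d0).
by rewrite !ltnS -addnn -addn1 leq_add2l.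
Qed.

Lemma lead_commB d a b : (0 < d)%N ->
  lead_comm d a -> lead_comm d b -> lead_comm d (a - b).
Proof.
move=> d0 [g Tg ga] [z Tz zb]; exists (g * z^-1)%g;
  last exact: nt_add_cong_ldiv.
have [_ TM TV] := gen_subgroup_subgroup [set cm x y | x in [set: nottingham K]
  & y in [set: nottingham K]].
by apply: TM => //; apply: TV.
Qed.

Lemma lead_comm_cm m n (a : int) : (0 < m < n)%N ->
  lead_comm (m + n) (a * (n%:Z - m%:Z)).
Proof.
move=> mn; have /andP[m0 _] := mn.
exists (cm (nt_add m 1%R) (nt_add n (fpsC a%:~R))); first exact: NN_cm.
have RP k := nt_cong_congr K k.
apply: (cg_trans (RP _)).
  apply: fps_eqmod_le (nt_comm_mod _ mn).
  by rewrite -addnn addnA !ltnS addnC leq_addr.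
rewrite intrM intrB -!pmulrn -addn1 -addSn.
apply: nt_add_mod; rewrite ?addn_gt0 ?m0 //.
case: m m0 {mn} => // m _; rewrite exprS -mulrA -(expr1 X).
exact: fps_eqmodI.
Qed.

(* The cancellation of the two leading terms exposes the second-order term of the
   first commutator. *)
Lemma lead_comm2 m n m' n' (a a' : int) : (0 < m < n)%N -> (0 < m' < n')%N ->
  (m < m')%N -> (m + n = m' + n')%N ->
  a * (n%:Z - m%:Z) + a' * (n'%:Z - m'%:Z) = 0 ->
  lead_comm (m + n + m) (a * ('C(n.+1, 2)%:Z - m.+1%:Z * (n%:Z - m%:Z))).
Proof.
move=> mn mn' mm' sE aE; have /andP[m0 _] := mn;
  have s0 : (0 < m + n)%N by rewrite addn_gt0 m0.
exists (cm (nt_add m 1%R) (nt_add n (fpsC a%:~R)) *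
        cm (nt_add m' 1%R) (nt_add n' (fpsC a'%:~R)))%g.
  have [_ TM _] := gen_subgroup_subgroup [set cm x y | x in [set: nottingham K]
    & y in [set: nottingham K]].
  by apply: TM; apply: NN_cm.
have c1 := @nt_comm_mod K m n a%:~R mn;
  have c2 := @nt_comm_mod K m' n' a'%:~R mn'.
set k := (m + n + m).+2; have RP := nt_cong_congr K k.
have kE : k = (n + m.*2).+2 by rewrite /k; lia.
have {c2} c2 := fps_eqmod_le (m := k) (n := (n' + m'.*2).+2) ltac:(rewrite /k;
  lia) c2.
rewrite -kE in c1; rewrite -sE in c2.
apply: (cg_trans RP (cg_mul RP c1 c2)).
apply: (cg_trans RP).
  apply: fps_eqmod_le (nt_addM _ _ s0).
  by rewrite /k; lia.
rewrite addrACA -fpsCD.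
have -> : a%:~R * (n%:R - m%:R) + a'%:~R * (n'%:R - m'%:R) = 0 :> K.
  by rewrite !pmulrn -!intrB -!intrM -intrD aE.
rewrite fpsC0 add0r /nt_cong !nt_addE ?addn_gt0 ?m0 //.
apply/fps_eqmodE.
have [j m'E] : exists j, m' = (m + j.+1)%N by exists (m' - m).-1; lia.
set B' := fpsC (a'%:~R * _).
exists (X ^+ j * B').
rewrite m'E /k intrM intrB intrM intrB -!pmulrn !exprS !exprD !exprS.
by ring.
Qed.

(** By [lead_commB] the attained coefficients form an additive group. It contains [d - 2] and
    [d - 4], hence 2, so one odd member suffices. The bound on [d] gives room for inequalities such
    as [6 < d - 8]. *)
Lemma lead_comm1 d : (16 < d)%N -> lead_comm d 1.
Proof.
move=> d16; have d0 : (0 < d)%N by apply: leq_trans d16.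
have LB x y := @lead_commB d x y d0.
have e1 : (1 + (d - 1) = d)%N by lia.
have e2 : (2 + (d - 2) = d)%N by lia.
have L2 : lead_comm d 2.
  have L1 := @lead_comm_cm 1 (d - 1) 1 ltac:(lia).
  have L2 := @lead_comm_cm 2 (d - 2) 1 ltac:(lia).
  rewrite e1 in L1; rewrite e2 in L2.
  have := LB _ _ L1 L2; congr lead_comm; lia.
suff [q Lq] : exists q : int, lead_comm d (2 * q + 1).
  have := LB _ _ Lq (subr_closed_mulz LB L2 q); congr lead_comm; ring.
case: (boolP (odd d)) => dodd.
  have L1 := @lead_comm_cm 1 (d - 1) 1 ltac:(lia).
  rewrite e1 in L1; exists (d./2%:Z - 1).
  by move: L1; congr lead_comm; lia.
have [[k dE]|[k [dE|dE]]] : (exists k : nat, d = 4 * k)%N \/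
    (exists k : nat, d = 8 * k + 6 \/ d = 8 * k + 2)%N.
- have : (d %% 8 = 0 \/ d %% 8 = 2 \/ d %% 8 = 4 \/ d %% 8 = 6)%N by lia.
  by case=> [|[|[|]]] dm; [left; exists (d %/ 4)%N|right; exists (d %/ 8)%N|
    left; exists (d %/ 4)%N|right; exists (d %/ 8)%N]; lia.
(* The differences are [d - 3] and [d - 5], which dictates [a] and [a']. For [d = 4k] both [a] and
   [C(d-1, 2) = (4k-1)(2k-1)] are odd, and [2(d-3)] is even. *)
- have := @lead_comm2 1 (d - 2) 2 (d - 3) (d%:Z - 5) (- (d%:Z - 3))
    ltac:(lia) ltac:(lia) ltac:(lia) ltac:(lia) ltac:(lia).
  have -> : (1 + (d - 2) + 1 = d)%N by lia.
  have -> : ((d - 2).+1 = (2 * k - 1).*2.+1)%N by lia.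
  rewrite bin2odd ?oddS ?odd_double //= doubleK.
  set x : int := 2 * k%:Z - 3; set y : int := 4 * k%:Z ^+ 2 - 7 * k%:Z + 3.
  move=> L; exists (2 * x * y + x + y); move: L; congr lead_comm.
  rewrite PoszM.
  have -> : (2 * k - 1).*2.+1%:Z = 4 * k%:Z - 1 by lia.
  have -> : (2 * k - 1)%N%:Z = 2 * k%:Z - 1 by lia.
  have -> : (d - 2)%N%:Z = 4 * k%:Z - 2 by lia.
  have -> : d%:Z = 4 * k%:Z by lia.
  rewrite /x /y; ring.
(* For [d] congruent to 2 modulo 4 the choice [m = 1] gives an even second-order term. For
   [d = 8k + 6] the differences are [8k] and [8k - 4]; dividing by their factor 4 leaves [a] odd,
   and [C(8k+3, 2)] is odd. *)
- have := @lead_comm2 2 (d - 4) 4 (d - 6) (2 * k%:Z - 1) (- 2 * k%:Z)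
    ltac:(lia) ltac:(lia) ltac:(lia) ltac:(lia).
  have -> : (2 + (d - 4) + 2 = d)%N by lia.
  have -> : ((d - 4).+1 = (4 * k + 1).*2.+1)%N by lia.
  rewrite bin2odd ?oddS ?odd_double //= doubleK PoszM.
  have -> : (4 * k + 1).*2.+1%:Z = 8 * k%:Z + 3 by lia.
  have -> : (4 * k + 1)%N%:Z = 4 * k%:Z + 1 by lia.
  have -> : (d - 4)%N%:Z = 8 * k%:Z + 2 by lia.
  have -> : (d - 6)%N%:Z = 8 * k%:Z by lia.
  set x : int := k%:Z - 1; set y : int := 16 * k%:Z ^+ 2 - 2 * k%:Z + 1.
  move=> L; exists (2 * x * y + x + y); move: (L ltac:(ring)); congr lead_comm.
  rewrite /x /y; ring.
(* For [d = 8k + 2] the value [m' = 4] would force [a] to be even. With [m' = 6] the differences are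
   [4(2k-1)] and [4(2k-3)], so [a = 2k - 3] is odd, as is [C(8k-1, 2)]. *)
- have := @lead_comm2 2 (d - 4) 6 (d - 8) (2 * k%:Z - 3) (- (2 * k%:Z - 1))
    ltac:(lia) ltac:(lia) ltac:(lia) ltac:(lia).
  have -> : (2 + (d - 4) + 2 = d)%N by lia.
  have -> : ((d - 4).+1 = (4 * k - 1).*2.+1)%N by lia.
  rewrite bin2odd ?oddS ?odd_double //= doubleK PoszM.
  have -> : (4 * k - 1).*2.+1%:Z = 8 * k%:Z - 1 by lia.
  have -> : (4 * k - 1)%N%:Z = 4 * k%:Z - 1 by lia.
  have -> : (d - 4)%N%:Z = 8 * k%:Z - 2 by lia.
  have -> : (d - 8)%N%:Z = 8 * k%:Z - 6 by lia.
  set x : int := k%:Z - 2; set y : int := 16 * k%:Z ^+ 2 - 18 * k%:Z + 6.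
  move=> L; exists (2 * x * y + x + y); move: (L ltac:(ring)); congr lead_comm.
  rewrite /x /y; ring.
Qed.

(** One generator for each depth outside the range of [lead_comm1]; index 0 gives only the default
    value of [nt_add], the identity. *)
Definition nt_gens : set (nottingham K) := [set nt_add d 1%R | d in `I_17].

Lemma nottingham_top_generates : top_generates nt_gens.
Proof.
apply/nt_denseP; set L := gen_subgroup _.
have LS : is_subgroup L by apply: gen_subgroup_subgroup.
have [L1 LM LV] := LS.
suff LD d x : exists2 y, L y & nt_cong d.+1 y x.
  move=> x n; have [y Ly yx] := LD n x; exists y => //.
  exact: fps_eqmod_le yx.
elim: d x => [|d IH] x.
  by exists 1%g => // -[] // _; rewrite !nottingham0.
have [->|d0] := posnP d.
  by exists 1%g => // -[|[]] // _; rewrite ?nottingham0 ?nottingham1.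
have lead1 : exists2 c, L c & nt_cong d.+2 c (nt_add d (fpsC 1%:~R)).
  have [d17|d16] := ltnP d 17.
    exists (nt_add d 1%R); last by rewrite fpsC1;
      apply: (cg_refl (nt_cong_congr K _)).
    by apply: (@sub_gen_subgroup _ nt_gens); exists d.
  have [c Tc cE] := lead_comm1 d16.
  suff [l Ll lc] : exists2 l, L l & nt_cong d.+2 l c.
    by exists l => //; apply: (cg_trans (nt_cong_congr K _) lc).
  have RP := nt_cong_congr K d.+2; have RP' := nt_cong_congr K d.+1.
  apply: (@gen_subgroup_min _ _ [set c | exists2 l, L l & nt_cong d.+2 l c] _ _
    c Tc).
    split=> [|y z [l Ll ly] [m Lm mz]|y [l Ll ly]].
    - by exists 1%g.
    - by exists (l * m)%g; [apply: LM|apply: (cg_mul RP)].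
    - by exists l^-1%g; [apply: LV|apply: (cg_inv RP)].
  (* Approximations of [y] and [z] modulo [X^(d+1)] give their commutator modulo [X^(d+2)], since
     elements of depth [d] are central at that precision. *)
  move=> _ [y _ [z _ <-]]; have [l Ll ly] := IH y; have [m Lm mz] := IH z.
  exists (cm l m); first by apply: (subgroup_cm LS).
  apply: (cg_cm_central RP' RP _ ly mz) => g u.
  exact: nt_comm_cong.
have [y Ly yx] := IH x; have RP n := nt_cong_congr K n.
have xn := nt_lead (proj1 (cg_ldiv (RP _) _ _) (cg_sym (RP _) yx)) d0.
have [a aE] := int_onto (nt_val (y^-1 * x)%g d.+1).
have [c Lc cE] : exists2 c, L c & nt_cong d.+2 c (nt_add d (fpsC a%:~R)).
  pose P (a : int) := exists2 c, L c & nt_cong d.+2 c (nt_add d (fpsC a%:~R)).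
  rewrite -(mulr1 a); apply: (@subr_closed_mulz P) => // u v [g Lg gu] [z Lz
    zv].
  exists (g * z^-1)%g; last exact: nt_add_cong_ldiv.
  by apply: LM => //; apply: LV.
exists (y * c)%g; first exact: LM.
rewrite aE in xn; have := cg_trans (RP _) cE (cg_sym (RP _) xn).
by move=> /(cg_mull (RP _) y); rewrite mulVKg.
Qed.

Lemma riordan_tfg : top_finitely_generated (riordan K).
Proof.
exists ([set Riordan (us_1X K) 1%g] `|` [set Riordan 1%g g | g in nt_gens]).
split; last exact/riordan_top_generates/nottingham_top_generates.
rewrite finite_setU; split; first exact: finite_set1.
by do 2![apply: finite_image]; exact: finite_II.
Qed.

End Generation.

(** * Finite index *)

Section Index.
Local Open Scope group_scope.
Variable G : groupType.

Lemma coset_space_le (T : finType) (f : G -> T) (A B : set G) :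
  is_subgroup B ->
  (forall x y, A x -> A y -> f x = f y -> B (y^-1 * x)) ->
  (coset_space A B #<= `I_#|T|)%card.
Proof.
move=> Bg fB; pose phi x : nat := enum_rank (f x).
pose psi i := left_coset (xget 1 [set x | A x /\ phi x = i]) B.
have -> : coset_space A B = psi @` (phi @` A).
  rewrite image_comp; apply: eq_imagel => x Ax /=.
  have [] : [set y | A y /\ phi y = phi x] (xget 1 [set y | A y /\ phi y = phi
    x]).
    by apply: xgetPex; exists x.
  move=> Ay /ord_inj/enum_rank_inj fy.
  exact/(left_cosetP (fun _ : nat => Bg) 0%N)/fB.
apply: card_le_trans (card_image_le _ _) _; apply: subset_card_le.
by move=> _ [x _ <-]; rewrite /phi /=.
Qed.

(** Lagrange by counting on the set [T] of classes of [R], without a group structure on [T]. The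
    classes of [e] have equal size because translation by [rep u * (rep t)^-1] maps the class of [t]
    injectively into that of [u]. *)
Lemma index_dvd (R : G -> G -> Prop) (T : finType) (rep : T -> G) (tr : G -> T)
    (N : set G) :
  congruence R -> cancel rep tr -> (forall x y, tr x = tr y <-> R x y) ->
  is_subgroup N -> (forall x, R x 1 -> N x) ->
  exists2 k, (k %| #|T|)%N & (coset_space [set: G] N #= `I_k)%card.
Proof.
move=> RP repK trP Ng RN; have [N1 NM NV] := Ng.
pose e t u := `[< N ((rep t)^-1 * rep u) >].
have e_refl t : e t t by apply/asboolP; rewrite mulVg.
have e_sym t u : e t u -> e u t.
  by move=> /asboolP/NV tu; apply/asboolP; rewrite invgM invgK in tu.
have e_trans t u v : e t u -> e u v -> e t v.
  move=> /asboolP tu /asboolP uv; apply/asboolP.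
  by have := NM _ _ tu uv; rewrite mulgA mulgK.
pose root t := odflt t [pick u | e t u].
have e_root t : e t (root t).
  by rewrite /root; case: pickP => [u //|/(_ t)]; rewrite e_refl.
have rootP t u : (root t == root u) = e t u.
  apply/eqP/idP => [tu|tu].
    by apply: e_trans (e_root t) _; rewrite tu; apply: e_sym.
  have tuE : e t =1 e u.
    by move=> v; apply/idP/idP; apply: e_trans => //; apply: e_sym.
  rewrite /root (eq_pick tuE).
  by case: pickP => // /(_ u); rewrite e_refl.
have fiber_le t u : (#|[set v | e t v]%SET| <= #|[set v | e u v]%SET|)%N.
  pose shift v := tr (rep u * (rep t)^-1 * rep v).
  rewrite -(card_imset (f := shift)); last first.
    move=> v w /trP /(cg_mull RP (rep u * (rep t)^-1)^-1); rewrite !mulKg.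
    by move=> /trP; rewrite !repK.
  apply/subset_leq_card/fintype.subsetP => _ /imsetP[v tv ->];
    rewrite !inE in tv *.

  have /RN : R ((rep u * (rep t)^-1 * rep v)^-1 * rep (shift v)) 1.
    by apply: (proj1 (cg_ldiv RP _ _)); apply/trP; rewrite repK.
  by move=> /(NM _ _ tv); rewrite !invgM !invgK !mulgA mulgK mulVg mul1g.
pose t0 := tr 1; pose D := [set root t | t : T]%SET;
  pose n := #|[set v | e t0 v]%SET|.
have cardT : #|T| = (#|D| * n)%N.
  rewrite -[LHS]sum1_card (partition_big_imset root) /= -[RHS]sum_nat_const.
  apply: eq_bigr => _ /imsetP[u _ ->]; rewrite sum1dep_card.
  apply/eqP; rewrite /n eqn_leq; apply/andP; split.
    apply: leq_trans (fiber_le u t0);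
      apply/subset_leq_card/fintype.subsetP => v.
    by rewrite !finset.in_set rootP; exact: e_sym.
  apply: leq_trans (fiber_le t0 u) _;
    apply/subset_leq_card/fintype.subsetP => v.
  by rewrite !finset.in_set rootP; exact: e_sym.
exists #|D|; first by rewrite cardT dvdn_mulr.
pose c i := left_coset (rep (nth t0 (enum D) i)) N.
have -> : coset_space [set: G] N = c @` `I_#|D|.
  apply/seteqP; split=> [_ [x _ <-]|_ [i _ <-]];
    last by exists (rep (nth t0 (enum D) i)).
  have Dx : root (tr x) \in enum D by rewrite mem_enum imset_f.
  exists (index (root (tr x)) (enum D)); first by rewrite /= cardE index_mem.
  rewrite /c nth_index //.
  apply/(left_cosetP (fun _ : nat => Ng) 0%N).
  have /asboolP tN := e_sym _ _ (e_root (tr x)).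
  have /RN : R ((rep (tr x))^-1 * x) 1.
    by apply: (proj1 (cg_ldiv RP _ _)); apply/trP; rewrite repK.
  move=> /(NM _ _ tN).
  by rewrite !mulgA mulgK => /NV; rewrite invgM invgK.
apply: inj_card_eq => i j; rewrite !inE /= cardE => iD jD.
move=> /(left_cosetP (fun _ : nat => Ng) 0%N) ij.
have rootD k : (k < size (enum D))%N ->
  root (nth t0 (enum D) k) = nth t0 (enum D) k.
  move=> kD; have := mem_nth t0 kD; rewrite mem_enum => /imsetP[u _ ->].
  by apply/eqP; rewrite rootP; apply/e_sym/e_root.
apply/eqP; rewrite -(nth_uniq t0 iD jD (enum_uniq _)) -(rootD i iD) -(rootD j
  jD).
by rewrite rootP; apply/e_sym/asboolP.
Qed.

End Index.

(** * The pro-p property *)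

Section ProP.
Variables (p : nat) (F : finFieldType).
Hypotheses (p_prime : prime p) (charF : p \in [pchar F]).

Lemma card_finField_pchar : exists f, #|F| = (p ^ f)%N.
Proof. by have := card_pprimeChar charF; exists (logn p #|F|). Qed.

Lemma riordan_pro_p : pro_p p (riordan F).
Proof.
split; first exact: riordan_profinite.
move=> N Ng _ Nop.
have /rd_nbhsP[n nN] : nbhs (1%g : riordan F) N by apply: open_nbhs_nbhs;
  case: Ng.
(* The first [n] free coefficients of both components: their number of values is a power of [p], and
   the index of [N] divides it. *)
pose T := (n.-tuple F * n.-tuple F)%type.
pose rep (t : T) : riordan F :=
  Riordan (us_add 1 (FPS (fun i => t.1`_i))) (nt_add 1 (FPS (fun i => t.2`_i))).
pose tr (r : riordan F) : T :=
  ([tuple us_val (rd_h r) i.+1 | i < n], [tuple nt_val (rd_g r) i.+2 | i < n]).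
have repK : cancel rep tr.
  move=> [u v]; congr pair; apply: eq_from_tnth => i;
    rewrite tnth_mktuple (tnth_nth 0) /=.
    by rewrite us_addE // fpsDE expr1 fpsXMSE fps1E add0r.
  by rewrite nt_addE // fpsDE fpsXnME /= add0r subn2.
have trP x y : tr x = tr y <-> rd_cong n.+1 n.+2 x y.
  split=> [xy|[hE gE]].
    have hE (i : 'I_n) : us_val (rd_h x) i.+1 = us_val (rd_h y) i.+1.
      by have := congr1 (fun t : T => tnth t.1 i) xy; rewrite !tnth_mktuple.
    have gE (i : 'I_n) : nt_val (rd_g x) i.+2 = nt_val (rd_g y) i.+2.
      by have := congr1 (fun t : T => tnth t.2 i) xy; rewrite !tnth_mktuple.
    split=> [[|i]|[|[|i]]] // i_n;
      rewrite ?useriesP ?nottingham0 ?nottingham1 //.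
      exact: (hE (Ordinal (i_n : (i < n)%N))).
    exact: (gE (Ordinal (i_n : (i < n)%N))).
  congr pair; apply: eq_from_tnth => i; rewrite !tnth_mktuple.
    by apply: hE; rewrite ltnS.
  by apply: gE; rewrite !ltnS.
have RP := rd_cong_congr F (leqnSn n.+1).
have [|k kT Nk] := index_dvd RP repK trP Ng.
  by move=> x x1; apply: nN; apply: rd_cong_le x1; rewrite ltnW.
have [f cardF] := card_finField_pchar.
move: kT; rewrite card_prod !card_tuple cardF -!expnM -expnD.
by move=> /(dvdn_pfactor _ _ p_prime)[j _ kE]; exists j; rewrite -kE.
Qed.

Lemma riordan_infinite : infinite_set [set: riordan F].
Proof.
pose f (n : nat) : riordan F := Riordan (us_add n.+1 1%R) 1%g.
have f_inj : {in [set: nat] &, injective f}.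
  move=> m n _ _ /(congr1 (fun r => us_val (rd_h r))) /fpsP mn.
  wlog lt_mn : m n mn / (m < n)%N => [H|].
    by case: (ltngtP m n) => // mn'; [|symmetry]; apply: H.
  have := mn m.+1; rewrite !us_addE // !fpsDE !fpsXnME ltnn ltnS lt_mn subnn.
  by rewrite !fps1E add0r addr0 => /eqP; rewrite oner_eq0.
move=> /(sub_finite_set (@subsetT _ (f @` [set: nat]))).
by rewrite (eq_finite_set (inj_card_eq f_inj)) => /infinite_nat.
Qed.

End ProP.

(** * Lower central series *)

Section CommutatorFill.
Local Open Scope group_scope.
Variables (G : groupType) (R : nat -> G -> G -> Prop).
Implicit Types (x y z t s : G).
Hypothesis R_congr : forall k, congruence (R k).
Hypothesis R_decr : forall k x y, R k.+1 x y -> R k x y.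
Hypothesis R0 : forall x, R 0 x 1.
Hypothesis R_comm : forall k x u, R k u 1 -> R k.+1 (x * u) (u * x).
Variables a1 a2 : G.

(* The two factors suffice: modulo [R k.+2] the right-hand side is multiplicative
   in [z1] and [z2], so a layer can be filled one coefficient at a time. *)
Definition fill k t := exists z1 z2,
  [/\ R k z1 1, R k z2 1 & R k.+2 t (cm a1 z1 * cm a2 z2)].

Lemma R_le j k x y : (j <= k)%N -> R k x y -> R j x y.
Proof.
move=> /subnK <-; elim: (k - j)%N => // i IH /= xy.
by apply: IH; apply: R_decr; rewrite -addSn.
Qed.

Lemma R_cm k x u : R k u 1 -> R k.+1 (cm x u) 1.
Proof. by move=> u1; apply: (cg_cm1 (R_congr _)); apply: R_comm. Qed.

(** Commutators with entries [z1], [z2] of layer [k] lie in layer [k + 1], so modulo layer [k + 2]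
    they are central and move past the other factors. *)
Lemma cm_mul_mod k y1 y2 z1 z2 : R k z1 1 -> R k z2 1 ->
  R k.+2 (cm a1 (y1 * z1) * cm a2 (y2 * z2))
         (cm a1 y1 * cm a2 y2 * (cm a1 z1 * cm a2 z2)).
Proof.
move=> z11 z21; have RP := R_congr k.+2.
have conj a y z : R k z 1 -> R k.+2 (y * cm a z * y^-1) (cm a z).
  move=> zR; have := cg_mulr RP y^-1 (R_comm y (R_cm a zR)).
  by rewrite mulgK.
rewrite (cmM a1 y1 z1) (cmM a2 y2 z2) -(mulgA (cm a1 y1)) -(mulgA (cm a1 y1));
  apply: (cg_mull RP).
apply: (cg_trans RP (y := cm a1 z1 * (cm a2 y2 * cm a2 z2))).
  by apply: (cg_mul RP) (conj _ _ _ z11) (cg_mull RP _ (conj _ _ _ z21)).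
rewrite (mulgA (cm a1 z1)) (mulgA (cm a2 y2)).
apply: (cg_mulr RP); apply: (cg_sym RP); apply: R_comm; exact: R_cm.
Qed.

Lemma fill_mul k t s : fill k t -> fill k s -> fill k (t * s).
Proof.
move=> [y1 [y2 [y11 y21 tE]]] [z1 [z2 [z11 z21 sE]]].
have one x z : R k x 1 -> R k z 1 -> R k (x * z) 1.
  by move=> xR zR; have := cg_mul (R_congr k) xR zR; rewrite mulg1.
exists (y1 * z1), (y2 * z2); split; [exact: one|exact: one|].
apply: (cg_trans (R_congr _) (cg_mul (R_congr _) tE sE)).
by apply: (cg_sym (R_congr _)); apply: cm_mul_mod.
Qed.

Lemma cm1 x : cm x 1 = 1.
Proof. by rewrite /cm mulg1 mulgV invg1 mulg1. Qed.

Lemma fill_cm1 k z : R k z 1 -> fill k (cm a1 z).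
Proof.
move=> z1; exists z, 1; split=> //; first exact: (cg_refl (R_congr k)).
by rewrite cm1 mulg1; apply: (cg_refl (R_congr _)).
Qed.

Lemma fill_cm2 k z : R k z 1 -> fill k (cm a2 z).
Proof.
move=> z1; exists 1, z; split=> //; first exact: (cg_refl (R_congr k)).
by rewrite cm1 mul1g; apply: (cg_refl (R_congr _)).
Qed.

Lemma fill1 k t : R k.+2 t 1 -> fill k t.
Proof.
move=> t1; exists 1, 1; split; [exact: (cg_refl (R_congr k))..|].
by rewrite !cm1 mulg1.
Qed.

Lemma fill_ldiv k t s : fill k s -> fill k (s^-1 * t) -> fill k t.
Proof. by move=> fs /(fill_mul fs); rewrite mulVKg. Qed.

Variable k0 : nat.
Hypothesis R_fill : forall k t, (k0 <= k)%N -> R k.+1 t 1 -> fill k t.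

(** Successive approximation: the error left after step [j] lies in layer [k + j + 1], and filling
    it changes [y1] and [y2] only by elements of layer [k + j]. *)
Lemma fill_approx k t j : (k0 <= k)%N -> R k.+1 t 1 -> exists y1 y2,
  [/\ R k y1 1, R k y2 1 & R (k + j).+1 t (cm a1 y1 * cm a2 y2)].
Proof.
move=> k0k t1; elim: j => [|j [y1 [y2 [y11 y21 tE]]]].
  exists 1, 1; rewrite addn0 !cm1 mulg1; split=> //;
    exact: (cg_refl (R_congr k)).
have := proj1 (cg_ldiv (R_congr _) _ _) tE.
move=> /(R_fill (leq_trans k0k (leq_addr j k)))[z1 [z2 [z11 z21 sE]]].
have one y z : R k y 1 -> R (k + j) z 1 -> R k (y * z) 1.
  by move=> yR /(R_le (leq_addr j k)) zR; have := cg_mul (R_congr k) yR zR;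
    rewrite mulg1.
exists (y1 * z1), (y2 * z2); split; [exact: one|exact: one|].
rewrite addnS; have RP := R_congr (k + j).+2.
apply: (cg_trans RP _ (cg_sym RP (cm_mul_mod y1 y2 z11 z21))).
by have := cg_mull RP (cm a1 y1 * cm a2 y2) sE; rewrite mulVKg.
Qed.

Lemma lower_central_sub n : lower_central (G) n.+1 `<=` [set x | R n x 1].
Proof.
elim: n => [|n IH]; first by move=> x _; apply: R0.
apply: gen_subgroup_min; first exact: (cg_subgroup (R_congr _)).
by move=> _ [x _ [u /IH u1 <-]]; apply: R_cm.
Qed.

End CommutatorFill.

(** * Finite width from a filtration whose layers can be filled *)

Section FiniteWidth.
Local Open Scope group_scope.
Variables (F : finComPzRingType) (R : nat -> riordan F -> riordan F -> Prop).
Hypothesis R_congr : forall k, congruence (R k).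
Hypothesis R_decr : forall k x y, R k.+1 x y -> R k x y.
Hypothesis R_open : forall k, exists n, forall x y, rd_cong n n x y -> R k x y.
Hypothesis R_sep : forall n, exists k, forall x y, R k x y -> rd_cong n n x y.
Hypothesis R0 : forall x, R 0 x 1.
Hypothesis R_comm : forall k x u, R k u 1 -> R k.+1 (x * u) (u * x).
Variables (a1 a2 : riordan F) (k0 : nat).
Hypothesis R_fill : forall k t, (k0 <= k)%N -> R k.+1 t 1 -> fill R a1 a2 k t.

(* The approximate solutions form a decreasing sequence of non-empty subsets of a
   compact space, and a cluster point is an exact solution. *)
Lemma fill_exact k t : (k0 <= k)%N -> R k.+1 t 1 -> exists y1 y2,
  [/\ R k y1 1, R k y2 1 & t = cm a1 y1 * cm a2 y2].
Proof.
move=> k0k t1.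
pose B j := [set y : riordan F * riordan F | [/\ R k y.1 1, R k y.2 1 &
  R (k + j).+1 t (cm a1 y.1 * cm a2 y.2)]].
have BE : ProperFilter (filter_from [set: nat] B).
  apply: filter_from_proper; last first.
    by move=> j _; have [y1 [y2 yB]] :=
      fill_approx R_congr R_decr R_comm R_fill j k0k t1; exists (y1, y2).
  apply: filter_from_filter; first by exists 0%N.
  move=> i j _ _; exists (maxn i j) => // y [y11 y21 tE].
  by split; split=> //; apply: (R_le R_decr) tE;
    rewrite ltnS leq_add2l ?leq_maxl ?leq_maxr.
have [|[y1 y2] [_ yB]] :=
    compact_setX (@riordan_compact F) (@riordan_compact F) BE.
  by exists 0%N.
have yBj j : B j (y1, y2).
  have [n nR] := R_open (k + j).+1.
  have nb (y : riordan F) : nbhs y [set z | rd_cong n n z y].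
    by apply/rd_nbhsP; exists n.
  have [||[z1 z2] [[z11 z21 tE] /= [zy1 zy2]]] := yB (B j)
    ([set z | rd_cong n n z y1] `*` [set z | rd_cong n n z y2]).
  - by exists j.
  - by exists ([set z | rd_cong n n z y1], [set z | rd_cong n n z y2]).
  have RP i := R_congr i;
    have kj : (k <= (k + j).+1)%N by rewrite leqW ?leq_addr.
  split=> /=.
  - by apply: (cg_trans (RP _)) z11; apply: (R_le R_decr kj);
    apply/(cg_sym (RP _))/nR.
  - by apply: (cg_trans (RP _)) z21; apply: (R_le R_decr kj);
    apply/(cg_sym (RP _))/nR.
  apply: (cg_trans (RP _) tE).
  by apply: (cg_mul (RP _)); apply: (cg_cm (RP _));
    solve [exact: nR | exact: (cg_refl (RP _))].
exists y1, y2; split; [by have [] := yBj 0%N|by have [] := yBj 0%N|].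
apply: rd_eqP => n; have [j jn] := R_sep n; apply: jn.
have [_ _] := yBj j; apply: (R_le R_decr).
by rewrite leqW ?leq_addl.
Qed.

(** Since [fill_exact] writes an element exactly as a product of two commutators, the abstract lower
    central series is reached without taking closures. *)
Lemma lower_central_sup n : [set x | R (k0 + n) x 1] `<=` lower_central
  (riordan F) n.+1.
Proof.
elim: n => [//|n IH] t /=; rewrite addnS => /(fill_exact (leq_addr _ _)).
move=> [y1 [y2 [/IH y11 /IH y21 ->]]].
have [_ LM _] := gen_subgroup_subgroup [set g * h * g^-1 * h^-1 |
  g in [set: riordan F] & h in lower_central (riordan F) n.+1].
by apply: LM; apply: sub_gen_subgroup; [exists a1|exists a2] => //;
  [exists y1|exists y2].
Qed.

(** [gamma_(n+1)] lies in layer [n] and [gamma_(n+2)] contains layer [k0 + n + 1], so counting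
    classes between these two layers bounds the quotient. *)
Lemma finite_width_fill p B : infinite_set [set: riordan F] ->
  (forall n, exists (T : finType) (f : riordan F -> T), #|T| = (p ^ B)%N /\
    forall x y, R n x 1 -> R n y 1 -> f x = f y -> R (k0 + n.+1) x y) ->
  finite_width p (riordan F).
Proof.
move=> Finf H; split=> //; exists B => -[//|n] _.
have [T [f [<- fR]]] := H n; apply: (coset_space_le (f := f)).
  case: n {fR} => [|n]; exact: gen_subgroup_subgroup.
move=> x y /(lower_central_sub R_congr R0 R_comm) x1.
move=> /(lower_central_sub R_congr R0 R_comm) y1 xy.
by apply: lower_central_sup; apply: (proj1 (cg_ldiv (R_congr _) x y));
  apply: fR.
Qed.

End FiniteWidth.

(** The depth reached after [k] commutator steps according to [rd_cong_comm]. *)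
Fixpoint lc_depth p k : nat :=
  if k is j.+1 then
    let m := lc_depth p j in if (p %| m)%N then m.+2 else m.+1
  else 0%N.

Lemma lc_depth_lt p k : (lc_depth p k < lc_depth p k.+1)%N.
Proof. by rewrite /=; case: ifP. Qed.

Lemma lc_depth_leq2 p k j : (lc_depth p (k + j) <= lc_depth p k + j.*2)%N.
Proof.
elim: j => [|j IH]; first by rewrite !addn0.
rewrite addnS doubleS !addnS /=; case: ifP => _; rewrite !ltnS //.
exact: leqW.
Qed.

Lemma lc_depth_geq p k : (k <= lc_depth p k)%N.
Proof. by elim: k => // k IH; apply: leq_ltn_trans (lc_depth_lt p k). Qed.

Lemma lc_depth_gt p k : (0 < k)%N -> (k < lc_depth p k)%N.
Proof.
case: k => // k _; elim: k => [|k IH]; first by rewrite /= dvdn0.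
exact: leq_ltn_trans IH (lc_depth_lt p k.+1).
Qed.

(** * Filtrations refined by a cocycle *)

Section Twist.
Variables (F : finFieldType) (D : nottingham F -> useries F).
Hypothesis D_cocycle : forall g z, D (g * z)%g = (D g * us_subst g (D z))%g.

(** The cocycle identity makes this a homomorphism, so the depth of [D g] obeys the same commutator
    estimates as the depth in H. *)
Definition twist (g : nottingham F) : riordan F := Riordan (D g) g.

Lemma twistM g z : twist (g * z)%g = (twist g * twist z)%g.
Proof. by congr Riordan; rewrite D_cocycle. Qed.

Lemma cocycle1 : D 1%g = 1%g.
Proof. by apply: (@mulgI _ (D 1%g));
  rewrite -[X in (_ * X)%g]us_subst_id -D_cocycle !mulg1. Qed.

Lemma twist1 : twist 1%g = 1%g.
Proof. by rewrite /twist cocycle1. Qed.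

Lemma twistV g : twist (g^-1)%g = ((twist g)^-1)%g.
Proof. by apply: (@mulgI _ (twist g)); rewrite -twistM !mulgV twist1. Qed.

Lemma twist_cm g z : twist (cm g z) = cm (twist g) (twist z).
Proof. by rewrite /cm !twistM !twistV. Qed.

(* With the trivial cocycle, used in odd characteristic, the second condition
   follows from the first one. *)
Definition tw_cong a b c (x y : riordan F) :=
  rd_cong a b x y /\ rd_cong c b (twist (rd_g x)) (twist (rd_g y)).

Lemma tw_cong_congr a b c : (a <= b)%N -> (c <= b)%N ->
  congruence (tw_cong a b c).
Proof.
move=> ab cb; have P := rd_cong_congr F ab; have Q := rd_cong_congr F cb.
split=> [x|x y [xy txy]|x y z [xy txy] [yz tyz]|x x' y y' [xx txx] [yy tyy]].
- by split; [apply: (cg_refl P)|apply: (cg_refl Q)].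
- by split; [apply: (cg_sym P)|apply: (cg_sym Q)].
- by split; [apply: (cg_trans P) xy yz|apply: (cg_trans Q) txy tyz].
- by split; [apply: (cg_mul P)|rewrite !twistM; apply: (cg_mul Q)].
Qed.

Variables (p : nat) (charF : p \in [pchar F]).

Definition lc_cong k := tw_cong (lc_depth p k) (lc_depth p k).+2 (lc_depth p k).

Lemma lc_cong_congr k : congruence (lc_cong k).
Proof. by apply: tw_cong_congr; rewrite leqW. Qed.

Lemma lc_cong_decr k x y : lc_cong k.+1 x y -> lc_cong k x y.
Proof.
have lt := ltnW (lc_depth_lt p k);
  have lt2 : ((lc_depth p k).+2 <= (lc_depth p k.+1).+2)%N by [].
by case=> xy txy; split; [apply: rd_cong_le xy|apply: rd_cong_le txy].
Qed.

Lemma lc_cong0 x : lc_cong 0 x 1%g.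
Proof.
by split; (split; first by []) => -[|[|]] // _;
  rewrite ?nottingham0 ?nottingham1.
Qed.

Lemma natF_eq0 m : (m%:R == 0 :> F) = (p %| m)%N.
Proof. by rewrite (dvdn_pcharf charF). Qed.

Lemma lc_cong_comm k x u : lc_cong k u 1%g -> lc_cong k.+1 (x * u)%g (u * x)%g.
Proof.
have [d dE jE] : exists2 d, d = 1%N \/ d = 2%N /\ (lc_depth p k)%:R = 0 :> F &
    lc_depth p k.+1 = (lc_depth p k + d)%N.
  rewrite /=; case: ifP => pk; [exists 2%N|exists 1%N];
    rewrite ?addn2 ?addn1 //.
    by right; split=> //; apply/eqP; rewrite natF_eq0.
  by left.
case=> u1 tu1; rewrite /lc_cong jE; split; first exact: rd_cong_comm.
by rewrite !twistM; apply: rd_cong_comm => //; rewrite -twist1.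
Qed.

Hypothesis D_cont : forall k, exists n, forall g z,
  nt_cong n g z -> us_cong k (D g) (D z).

Lemma lc_cong_open k : exists n, forall x y, rd_cong n n x y -> lc_cong k x y.
Proof.
have [n nD] := D_cont (lc_depth p k);
  exists (maxn n (lc_depth p k).+2) => x y xy.
have [xh xg] : rd_cong (lc_depth p k) (lc_depth p k).+2 x y.
  by apply: rd_cong_le xy; rewrite ?leq_maxr // leq_max; apply/orP; right;
    do 2! apply: leqW.
split; split=> //=; apply: nD; case: xy => _; apply: fps_eqmod_le.
by rewrite leq_maxl.
Qed.

Lemma lc_cong_sep n : exists k, forall x y, lc_cong k x y -> rd_cong n n x y.
Proof.
exists n => x y [xy _]; apply: rd_cong_le xy; rewrite ?lc_depth_geq //.
by rewrite !leqW ?lc_depth_geq.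
Qed.

(** Passing [k] layers raises the depth by at most [2k], so [2k] coefficients of each of [h], [g]
    and [D g] decide the class. *)
Lemma lc_cong_count k n : exists (T : finType) (f : riordan F -> T),
  #|T| = (#|F| ^ (6 * k))%N /\
  forall x y, lc_cong n x 1%g -> lc_cong n y 1%g -> f x = f y ->
    lc_cong (n + k) x y.
Proof.
set m := lc_depth p n; set w := k.*2.
exists (w.-tuple F * w.-tuple F * w.-tuple F)%type.
exists (fun x => ([tuple us_val (rd_h x) (m + i)%N | i < w],
  [tuple nt_val (rd_g x) (m.+2 + i)%N | i < w],
  [tuple us_val (D (rd_g x)) (m + i)%N | i < w])).
split; first by rewrite !card_prod !card_tuple -!expnD; congr (_ ^ _)%N;
  rewrite /w; lia.
have ext a (f g : fps F) : fps_eqmod a f g ->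
    (forall i : 'I_w, f (a + i)%N = g (a + i)%N) -> fps_eqmod (a + w) f g.
  move=> fg fgw i; have [/fg //|ai] := ltnP i a.
  rewrite -(subnKC ai) ltn_add2l => iw; exact: (fgw (Ordinal iw)).
move=> x y x1 y1 xy; have [[hxy gxy] [dxy _]] :=
  cg_trans (lc_cong_congr n) x1 (cg_sym (lc_cong_congr n) y1).
have hE : us_cong (m + w) (rd_h x) (rd_h y).
  apply: ext => // i; have := congr1 (fun t => tnth t.1.1 i) xy.
  by rewrite /= !tnth_mktuple.
have gE : nt_cong (m.+2 + w) (rd_g x) (rd_g y).
  apply: ext => // i; have := congr1 (fun t => tnth t.1.2 i) xy.
  by rewrite /= !tnth_mktuple.
have dE : us_cong (m + w) (D (rd_g x)) (D (rd_g y)).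
  apply: ext => // i; have := congr1 (fun t => tnth t.2 i) xy.
  by rewrite /= !tnth_mktuple.
have le := lc_depth_leq2 p n k; rewrite -/m -/w in le.
by split; split; [apply: fps_eqmod_le hE|apply: fps_eqmod_le gE|
  apply: fps_eqmod_le dE|apply: fps_eqmod_le gE].
Qed.

Definition rd_gen j : riordan F := Riordan 1%g (nt_add j 1%R).

Lemma finite_width_twist :
  (forall k t, (2 <= k)%N -> lc_cong k.+1 t 1%g ->
    fill lc_cong (rd_gen 1) (rd_gen 2) k t) ->
  finite_width p (riordan F).
Proof.
move=> H; have [f cardF] := card_finField_pchar charF.
(* With [k0 = 2] layer [n] is compared with layer [n + 3]: this takes [6 * 3 = 18] coefficients in
   [F], each with [p ^ f] values. *)
apply: (finite_width_fill lc_cong_congr lc_cong_decr lc_cong_open lc_cong_sep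
  lc_cong0
  lc_cong_comm H (B := (f * 18)%N)) => [|n].
  exact: riordan_infinite.
have [T [phi [cardT phiP]]] := lc_cong_count 3 n.
exists T, phi; split; first by rewrite cardT cardF -expnM.
by move=> x y x1 y1 xy; rewrite add2n -addn3; apply: phiP.
Qed.

(** The commutator has leading coefficient [n b], and [n] is invertible in [F]. In [nt_step] the
    divisor is [n - j]. *)
Lemma us_step j n m (h : useries F) : m = (n + j)%N -> (0 < n)%N -> (0 < j)%N ->
  ~~ (p %| n)%N -> us_cong m h 1%g -> exists b,
    us_cong m.+1 h (us_subst (nt_add j 1%R) (us_add n (fpsC b)) * (us_add n
      (fpsC b))^-1)%g.
Proof.
move=> -> n0 j0 pn h1.
have nF : n%:R != 0 :> F by rewrite natF_eq0.
exists (n%:R^-1 * us_val h (n + j)%N).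
have RP := us_cong_congr F (n + j).+1.
apply: (cg_trans RP (us_lead h1 _)); first by rewrite addn_gt0 n0.
apply: (cg_sym RP).
by have := us_comm_mod (n%:R^-1 * us_val h (n + j)%N) n0 j0; rewrite mulVKf.
Qed.

Lemma nt_step j n m (g : nottingham F) : m = (j + n)%N -> (0 < j < n)%N ->
  ~~ (p %| n - j)%N -> nt_cong m.+1 g 1%g -> exists b,
    nt_cong m.+2 g (cm (nt_add j 1%R) (nt_add n (fpsC b))).
Proof.
move=> mE jn pn g1; have /andP[j0 jn'] := jn.
have nF : n%:R - j%:R != 0 :> F by rewrite -natrB ?natF_eq0 // ltnW.
pose b := nt_val g m.+1 / (n%:R - j%:R); exists b.
have RP := nt_cong_congr F m.+2.
apply: (cg_trans RP (nt_lead g1 _)); first by rewrite mE addn_gt0 j0.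
apply: (cg_sym RP); apply: (cg_trans RP).
  by apply: fps_eqmod_le (nt_comm_mod _ jn); rewrite mE; lia.
rewrite /b mulfVK // -mE -[m.+2]addn1.
apply: nt_add_mod; rewrite ?mE ?addn_gt0 ?j0 //.
case: j j0 {mE jn jn' pn nF b} => // j _;
  rewrite exprS -mulrA -(expr1 (fpsX F)).
exact: fps_eqmodI.
Qed.

(** [d] drops out because H is commutative; the formula therefore also covers commutators with
    twisted elements. *)
Lemma cm_us (d : useries F) g (y : useries F) :
  cm (Riordan d g) (Riordan y 1%g) = Riordan (us_subst g y * y^-1)%g 1%g.
Proof.
apply: (@mulIg _ (Riordan y 1%g * Riordan d g)%g); rewrite cm_mul.
congr Riordan; rewrite /= ?us_subst_id ?mul1g ?mulg1 // mulgA mulgVK.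
by apply/val_inj; rewrite /= mulrC.
Qed.

Lemma cm_nt g (z : nottingham F) :
  cm (Riordan 1%g g) (Riordan 1%g z) = Riordan 1%g (cm g z).
Proof.
by congr Riordan; rewrite /= ?us_subst1 ?invg1 ?us_subst1 ?mulg1.
Qed.

Lemma fill_rd_gen k j z : (0 < j <= 2)%N -> lc_cong k z 1%g ->
  fill lc_cong (rd_gen 1) (rd_gen 2) k (cm (rd_gen j) z).
Proof.
case: j => [|[|[|]]] // _ z1.
  exact: (fill_cm1 lc_cong_congr).
exact: (fill_cm2 lc_cong_congr).
Qed.

Lemma lc_cong_us k (h : useries F) :
  us_cong (lc_depth p k) h 1%g -> lc_cong k (Riordan h 1%g) 1%g.
Proof. by move=> h1; split; split. Qed.

Lemma lc_cong_nt k (g : nottingham F) : us_cong (lc_depth p k) (D g) 1%g ->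
  nt_cong (lc_depth p k).+2 g 1%g -> lc_cong k (Riordan 1%g g) 1%g.
Proof. by move=> Dg g1; split; split; rewrite //= cocycle1. Qed.

(** Reduces filling [t] to filling a quotient [t'] in which the coefficient of [x^m] in H is
    cleared, with N and [D] kept at their precision. *)
Lemma fill_us k j n m b c t : m = (n + j)%N -> (0 < n)%N -> (0 < j <= 2)%N ->
  ~~ (p %| n)%N -> (lc_depth p k <= n)%N -> (m < b)%N -> (c <= b)%N ->
  tw_cong m b c t 1%g ->
  (forall t', tw_cong m.+1 b c t' 1%g ->
    fill lc_cong (rd_gen 1) (rd_gen 2) k t') ->
  fill lc_cong (rd_gen 1) (rd_gen 2) k t.
Proof.
move=> mE n0 j2 pn kn mb cb [[th tg] [tD _]]; have /andP[j0 _] := j2.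
have [e tE] := us_step mE n0 j0 pn th; set y := us_add n _ in tE.
have y1 : lc_cong k (Riordan y 1%g) 1%g.
  apply: lc_cong_us; rewrite /us_cong us_addE //.
  exact: fps_eqmod_le kn (@fps_eqmodI _ _ _ _).
move=> H; apply: (fill_ldiv lc_cong_congr lc_cong_comm (fill_rd_gen j2 y1)).
apply: H; apply: (proj1 (cg_ldiv (tw_cong_congr mb cb) _ _)).
by rewrite cm_us; split; split.
Qed.

(** The analogue for the coefficient of [x^(m+1)] in N. The commutator may also affect [D]; the two
    conditions on [D] keep its entry in layer [k] and preserve the precision [c]. *)
Lemma fill_nt k j n m a c t : m = (j + n)%N -> (0 < j < n)%N -> (j <= 2)%N ->
  ~~ (p %| n - j)%N -> (lc_depth p k < n)%N -> (a <= m.+2)%N -> (c <= m.+2)%N ->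
  (forall b, us_cong (lc_depth p k) (D (nt_add n (fpsC b))) 1%g) ->
  (forall b, us_cong c (D (cm (nt_add j 1%R) (nt_add n (fpsC b)))) 1%g) ->
  tw_cong a m.+1 c t 1%g ->
  (forall t', tw_cong a m.+2 c t' 1%g ->
    fill lc_cong (rd_gen 1) (rd_gen 2) k t') ->
  fill lc_cong (rd_gen 1) (rd_gen 2) k t.
Proof.
move=> mE jn j2 pn kn am cm Dz Dc [[th tg] [tD _]]; have /andP[j0 _] := jn.
have [e tE] := nt_step mE jn pn tg; set z := nt_add n _ in tE.
have z1 : lc_cong k (Riordan 1%g z) 1%g.
  apply: lc_cong_nt; first exact: Dz.
  rewrite /nt_cong nt_addE ?(leq_trans _ kn) //.
  exact: fps_eqmod_le (@fps_eqmodI _ _ _ _).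
have j02 : (0 < j <= 2)%N by rewrite j0.
move=> H; apply: (fill_ldiv lc_cong_congr lc_cong_comm (fill_rd_gen j02 z1)).
apply: H; apply: (proj1 (cg_ldiv (tw_cong_congr am cm) _ _)).
rewrite cm_nt; split; split=> //=.
apply: (cg_trans (us_cong_congr F c) tD).
by rewrite /= cocycle1; apply: (cg_sym (us_cong_congr F c)); apply: Dc.
Qed.

End Twist.

(** With [e] the previous depth, the number is [e + 1] if [p] divides [e], and [e] otherwise. *)
Lemma lc_depth_pred p k : prime p -> ~~ (p %| lc_depth p k.+1 - 1)%N.
Proof.
move=> p_pr /=; case: ifPn => [pj|]; last by rewrite subn1.
by rewrite subn1 /= -addn1 dvdn_addr // dvdn1 neq_ltn prime_gt1 ?orbT.
Qed.

(** * Finite width in odd characteristic *)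

Section OddCharacteristic.
Variables (F : finFieldType) (p : nat).
Hypotheses (p_prime : prime p) (charF : p \in [pchar F]) (p_odd : p != 2%N).

Let one_cocycle : nottingham F -> useries F := fun=> 1%g.

Lemma finite_width_odd : finite_width p (riordan F).
Proof.
have D_cocycle (g z : nottingham F) : one_cocycle (g * z)%g = (one_cocycle g *
  us_subst g (one_cocycle z))%g.
  by rewrite /one_cocycle us_subst1 mulg1.
have Dc k : exists n, forall g z, nt_cong n g z ->
  us_cong k (one_cocycle g) (one_cocycle z).
  by exists 0%N.
apply: (finite_width_twist D_cocycle charF Dc) => k t k2.
have f3 : (2 < lc_depth p k)%N.
  by apply: leq_ltn_trans (lc_depth_gt p _); rewrite // ltnW.
have lt1 := lc_depth_lt p k; have lt2 := lc_depth_lt p k.+1.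
(* The depths from [lc_depth p k.+1] up to [lc_depth p k.+2] are cleared one at a time, by induction
   on a bound [i] for the number left. *)
suff H i m s : (lc_depth p k.+1 <= m)%N -> (lc_depth p k.+2 <= m + i)%N ->
    tw_cong one_cocycle m m.+2 m s 1%g ->
      fill (lc_cong one_cocycle p) (rd_gen F 1) (rd_gen F 2) k s.
  by apply: (H (lc_depth p k.+2)) => //; rewrite leq_addl.
elim: i m s => [|i IH] m s km kmi s1.
  apply: fill1; first exact: lc_cong_congr.
  rewrite addn0 in kmi; case: s1 => s1 ts1.
  by split; [apply: rd_cong_le s1|apply: rd_cong_le ts1].
have {}IH s' : tw_cong one_cocycle m.+1 m.+3 m.+1 s' 1%g ->
    fill (lc_cong one_cocycle p) (rd_gen F 1) (rd_gen F 2) k s'.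
  by apply: IH; [exact: leqW|rewrite addSn -addnS].
have trivD (b c : nat) (x : riordan F) a : tw_cong one_cocycle a b c x 1%g ->
  tw_cong one_cocycle a b a x 1%g.
  by move=> [[xh xg] _]; split; split.
(* With [j = 1] the divisors in N and in H are both [m - 1]. If [p] divides it, [j = 2] gives the
   divisors [m - 3] and [m - 2], congruent to -2 and -1. *)
have [pm|pm] := boolP (p %| m - 1)%N.
  (* Strictness is what places the entry of depth [m - 2] used for H in layer [k]. *)
  have km' : (lc_depth p k.+1 < m)%N.
    rewrite ltn_neqAle km andbT; apply/eqP => mE.
    by have := lc_depth_pred k p_prime; rewrite mE pm.
  have p2 : ~~ (p %| m - 2)%N.
    apply/negP => pm2; have : (p %| (m - 1) - (m - 2))%N by apply: dvdn_sub.
    have -> : (m - 1 - (m - 2) = 1)%N by lia.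
    by rewrite dvdn1 => /eqP p1; have := prime_gt1 p_prime; rewrite p1.
  have p3 : ~~ (p %| (m - 1) - 2)%N.
    apply/negP => pm2; have : (p %| (m - 1) - (m - 1 - 2))%N by apply: dvdn_sub.
    have -> : (m - 1 - (m - 1 - 2) = 2)%N by lia.
    by rewrite dvdn_prime2 // (negPf p_odd).
  apply: (fill_nt D_cocycle charF (j := 2) (n := m - 1) (m := m.+1)) s1 _;
    rewrite //; try lia.
  move=> s' s1; apply: (fill_us D_cocycle charF (j := 2) (n := m - 2)) s1 _;
    rewrite //; try lia.
  by move=> t' /trivD; apply: IH.
apply: (fill_nt D_cocycle charF (j := 1) (n := m) (m := m.+1)) s1 _;
  rewrite //; try lia.
move=> s' s1; apply: (fill_us D_cocycle charF (j := 1) (n := m - 1)) s1 _;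
  rewrite //; try lia.
by move=> t' /trivD; apply: IH.
Qed.

End OddCharacteristic.

(** * Finite width in characteristic two *)

Section CharacteristicTwo.
Variable F : finFieldType.
Hypothesis charF : 2%N \in [pchar F].
Notation X := (fpsX F).

(** The inverse of Frobenius, as [x ^+ #|F| = x] and [#|F|] is even. *)
Definition sqrt2 (x : F) : F := x ^+ (#|F| %/ 2).

Lemma sqrt2K x : sqrt2 x ^+ 2 = x.
Proof.
have [f cardF] := card_finField_pchar charF.
have f0 : (0 < f)%N.
  by case: f cardF => // cardF; have := finNzRing_gt1 F; rewrite cardF.
by rewrite /sqrt2 -exprM divnK ?expf_card // cardF dvdn_exp.
Qed.

Lemma addff2 (x : F) : x + x = 0.
Proof. exact: (addrr_pchar2 charF). Qed.

Lemma sqrt2_sqr x : sqrt2 (x ^+ 2) = x.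
Proof.
apply/eqP; rewrite -subr_eq0 -sqrf_eq0 sqrrB sqrt2K.
by rewrite mulr2n addff2 subr0 addff2.
Qed.

Lemma sqrt21 : sqrt2 1 = 1.
Proof. by rewrite /sqrt2 expr1n. Qed.

Lemma fps_addff2 (f : fps F) : f + f = 0.
Proof. by apply/fpsP => n; rewrite fpsDE addff2. Qed.

Lemma fps_sqrD (f g : fps F) : (f + g) ^+ 2 = f ^+ 2 + g ^+ 2.
Proof.
have -> : (f + g) ^+ 2 = f ^+ 2 + g ^+ 2 + (f * g + f * g) by ring.
by rewrite fps_addff2 addr0.
Qed.

Lemma fps_sqrE (f : fps F) n : (f ^+ 2) n = if odd n then 0 else f n./2 ^+ 2.
Proof.
elim/ltn_ind: n f => n IH f; have fE := fps_split f; set g := FPS _ in fE.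
rewrite {1}fE fps_sqrD exprMn [fpsC _ ^+ 2]expr2 -fpsCM -expr2 fpsDE fpsXnME.
case: n IH => [|[|n]] IH.
- by rewrite addr0 /= mulr1n.
- by rewrite addr0 /=.
have -> : fpsC (f 0%N ^+ 2) n.+2 = 0 by [].
have -> : (n.+2 < 2)%N = false by [].
by rewrite add0r subSS subSS subn0 IH //= negbK.
Qed.

Definition sqrt_even (f : fps F) : fps F := FPS (fun i => sqrt2 (f i.*2)).
Definition sqrt_odd (f : fps F) : fps F := FPS (fun i => sqrt2 (f i.*2.+1)).

Lemma sqrt_splitE (f : fps F) : f = X * sqrt_odd f ^+ 2 + sqrt_even f ^+ 2.
Proof.
apply/fpsP => -[|n]; rewrite fpsDE ?fpsXM0E ?fpsXMSE !fps_sqrE /=.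
  by rewrite add0r sqrt2K.
case: ifP => /= n2; rewrite ?addr0 ?add0r sqrt2K; congr (f _).
  by rewrite uphalfE; lia.
lia.
Qed.

Lemma sqrt_odd_split (a b : fps F) : sqrt_odd (X * a ^+ 2 + b ^+ 2) = a.
Proof.
apply/fpsP => n; rewrite [LHS]/(sqrt2 ((X * a ^+ 2 + b ^+ 2) n.*2.+1)).
rewrite fpsDE fpsXMSE !fps_sqrE /= odd_double /= addr0.
by rewrite doubleK; exact: sqrt2_sqr.
Qed.

(* The square root of the derivative of [g]: the chain rule becomes the cocycle
   identity [sqrt_derivM]. *)
Definition sqrt_deriv (g : nottingham F) : useries F :=
  insubd (us_one F) (sqrt_odd (nt_val g)).

Lemma sqrt_derivE g : us_val (sqrt_deriv g) = sqrt_odd (nt_val g).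
Proof.
apply: (@insubdK _ _ (useries F)); rewrite unfold_in /=.
by rewrite nottingham1 sqrt21.
Qed.

Lemma sqrt_deriv_uniq g (d : useries F) b :
  nt_val g = X * us_val d ^+ 2 + b ^+ 2 -> sqrt_deriv g = d.
Proof. by move=> gE; apply/val_inj;
  rewrite /= sqrt_derivE gE sqrt_odd_split. Qed.

(** Substituting [g = X d^2 + b^2] into [z = X e^2 + c^2] gives
    [z(g) = X (d e(g))^2 + (b e(g) + c(g))^2], and the odd part determines the square root. *)
Lemma sqrt_derivM g z : sqrt_deriv (g * z)%g = (sqrt_deriv g * us_subst g
  (sqrt_deriv z))%g.
Proof.
have g0 := nottingham0 g.
apply: (@sqrt_deriv_uniq _ _ (sqrt_even (nt_val g) * fps_comp (us_val
  (sqrt_deriv z)) (nt_val g)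
  + fps_comp (sqrt_even (nt_val z)) (nt_val g))).
rewrite fps_sqrD us_mulE nt_mulE [us_val (us_subst g (sqrt_deriv z))]/=.
rewrite {1}(sqrt_splitE (nt_val z)) -sqrt_derivE fps_compD fps_compM //
  fps_compXl //.
rewrite !fps_compXn // {1}(sqrt_splitE (nt_val g)) -sqrt_derivE.
ring.
Qed.

Lemma sqrt_deriv_cont k : exists n, forall g z,
  nt_cong n g z -> us_cong k (sqrt_deriv g) (sqrt_deriv z).
Proof.
exists k.*2 => g z gz i ik; rewrite !sqrt_derivE /= gz //.
by rewrite -doubleS leq_double.
Qed.

Lemma sqrt_deriv_nt_even n (b : F) : (0 < n)%N -> ~~ odd n.+1 ->
  sqrt_deriv (nt_add n (fpsC b)) = 1%g.
Proof.
move=> n0 n2; apply: (@sqrt_deriv_uniq _ _ (X ^+ n.+1./2 * fpsC (sqrt2 b))).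
rewrite nt_addE // exprMn -exprM muln2 even_halfK // expr1n mulr1.
by rewrite expr2 -fpsCM -expr2 sqrt2K.
Qed.

Lemma sqrt_deriv_nt_odd n (b : F) : (0 < n)%N ->
  sqrt_deriv (nt_add n.*2 (fpsC (b ^+ 2))) = us_add n (fpsC b).
Proof.
move=> n0; apply: (@sqrt_deriv_uniq _ _ 0).
rewrite nt_addE ?double_gt0 // us_addE // fps_sqrD expr1n exprMn.
by rewrite -exprM muln2 exprS expr2 fpsCM; ring.
Qed.

Lemma lc_depth2 k : lc_depth 2 k = k.*2.
Proof. by elim: k => // k IH; rewrite /= IH dvdn2 odd_double. Qed.

Notation tw := (tw_cong sqrt_deriv).

(** As [m + 3] is odd, that coefficient of [g] is the square of the coefficient of index [m/2 + 1]
    of [D g], which is already known to vanish. *)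
Lemma tw_parity a m t : ~~ odd m -> tw a m.+3 m.+2 t 1%g ->
  tw a m.+4 m.+2 t 1%g.
Proof.
move=> m2 [[th tg] [tD _]]; have tg' : nt_cong m.+4 (rd_g t) 1%g.
  apply: fps_eqmod_next tg _; rewrite nt_oneE /=.
  have tDE : us_cong m.+2 (sqrt_deriv (rd_g t)) 1%g by move: tD;
    rewrite /= (cocycle1 sqrt_derivM).
  have := tDE m./2.+1; rewrite sqrt_derivE us_oneE fps1E [_ == _]/= => tm.
  have mE : m./2.+1.*2.+1 = m.+3 by rewrite doubleS even_halfK.
  rewrite -mE -[LHS]sqrt2K; move: tm => /= ->; first by rewrite expr0n.
  by rewrite !ltnS; lia.
by split; split.
Qed.

(** [z = x + e^2 x^(2n+1)] has [D z = 1 + e x^n], while [b <= 2n] hides it in N. Its twist thus acts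
    like an element of H, and [cm_us] applies. *)
Lemma fill_D k j n m b t : m = (n + j)%N -> (0 < n)%N -> (0 < j <= 2)%N ->
  ~~ (2 %| n)%N -> (lc_depth 2 k <= n)%N -> (m < b)%N -> (b <= n.*2)%N ->
  forall a, (a <= b)%N -> tw a b m t 1%g ->
  (forall t', tw a b m.+1 t' 1%g ->
    fill (lc_cong sqrt_deriv 2) (rd_gen F 1) (rd_gen F 2) k t') ->
  fill (lc_cong sqrt_deriv 2) (rd_gen F 1) (rd_gen F 2) k t.
Proof.
move=> mE n0 j2 pn kn mb bn a ab [[th tg] [tD _]]; have /andP[j0 _] := j2.
have D_cocycle := sqrt_derivM; have RPb := nt_cong_congr F b.
move: tD; rewrite /= (cocycle1 D_cocycle) => tD.
have [e tE] := us_step charF mE n0 j0 pn tD; set y := us_add n _ in tE.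
pose z := nt_add n.*2 (fpsC (e ^+ 2)).
have zD : sqrt_deriv z = y by apply: sqrt_deriv_nt_odd.
have zn : nt_cong n.*2.+1 z 1%g.
  by rewrite /nt_cong nt_addE ?double_gt0 //; exact: fps_eqmodI.
have z1 : lc_cong sqrt_deriv 2 k (Riordan 1%g z) 1%g.
  apply: lc_cong_nt => //; last first.
    apply: fps_eqmod_le zn; lia.
  rewrite zD /us_cong us_addE //.
  exact: fps_eqmod_le kn (@fps_eqmodI _ _ _ _).
move=> H; apply: (fill_ldiv (lc_cong_congr D_cocycle 2) (lc_cong_comm D_cocycle
  charF) (fill_rd_gen D_cocycle j2 z1)).
apply: H; apply: (proj1 (cg_ldiv (tw_cong_congr D_cocycle ab mb) _ _)).
have cz1 : nt_cong b (cm (nt_add j 1%R) z) 1%g.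
  have := cg_cm RPb (cg_refl RPb (nt_add j 1%R)) (fps_eqmod_le (leqW bn) zn).
  by rewrite cm1.
have tc : nt_cong b (rd_g t) (cm (nt_add j 1%R) z).
  exact: (cg_trans RPb tg (cg_sym RPb cz1)).
rewrite cm_nt; split; split=> //=.
have RP := rd_cong_congr F (leqnSn m.+1).
have : rd_cong m.+1 m.+2 (twist sqrt_deriv (cm (nt_add j 1%R) z))
    (cm (twist sqrt_deriv (nt_add j 1%R)) (Riordan y 1%g)).
  rewrite (twist_cm D_cocycle); apply: (cg_cm RP); first exact: (cg_refl RP).
  split=> /=; first by rewrite zD.
  apply: fps_eqmod_le zn; lia.
rewrite cm_us => -[/= cE _].
exact: (cg_trans (us_cong_congr F _) tE (cg_sym (us_cong_congr F _) cE)).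
Qed.

Lemma finite_width_char2 : finite_width 2 (riordan F).
Proof.
have D_cocycle := sqrt_derivM.
apply: (finite_width_twist D_cocycle charF sqrt_deriv_cont) => k t k2 t1.
have {t1} t1 : tw k.*2.+2 k.*2.+4 k.*2.+2 t 1%g.
  by move: t1; rewrite /lc_cong lc_depth2 doubleS.
have o1 : ~~ (2 %| k.*2.+2 - 1)%N by rewrite dvdn2 subn1 /= odd_double.
have ku n : (k.*2 <= n)%N -> (lc_depth 2 k <= n)%N by rewrite lc_depth2.
(* No explicit computation of this [D]: the entry lies in layer [k], so the commutator lies in layer
   [k + 1], where [D] has depth [2k + 2]. *)
have cmD b : us_cong k.*2.+2 (sqrt_deriv (cm (nt_add 2 1%R) (nt_add k.*2.+1
  (fpsC b)))) 1%g.
  have z1 : lc_cong sqrt_deriv 2 k (Riordan 1%g (nt_add k.*2.+1 (fpsC b))) 1%g.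
    apply: (lc_cong_nt D_cocycle);
      first by rewrite sqrt_deriv_nt_even //= odd_double.
    rewrite /nt_cong nt_addE // lc_depth2; exact: fps_eqmodI.
  have := R_cm (lc_cong_congr D_cocycle 2) (lc_cong_comm D_cocycle charF)
    (rd_gen F 2) z1.
  by rewrite cm_nt => -[_ [+ _]]; rewrite lc_depth2 /= (cocycle1 D_cocycle).
(* The coefficient of [x^(2k+4)] in N comes first because its commutator may change [D]. Then [D]
   and H are cleared at [2k + 2] and [2k + 3], and [x^(2k+5)] in N follows from [tw_parity]. In
   [fill_D], [2 <= k] ensures [2k + 5 <= 2n]. *)
apply: (fill_nt D_cocycle charF (j := 2) (n := k.*2.+1) (m :=
  k.*2.+3)) t1 _ => //; try lia.
- by rewrite lc_depth2.
- by move=> b; rewrite sqrt_deriv_nt_even //= odd_double.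
move=> {}t t1; apply: (fill_D (j := 1) (n := k.*2.+1) (b := k.*2.+4.+1)) t1 _;
  rewrite ?lc_depth2 //; try lia.
move=> {}t t1; apply: (fill_D (j := 2) (n := k.*2.+1) (b := k.*2.+4.+1)) t1 _;
  rewrite ?lc_depth2 //; try lia.
move=> {}t t1; apply: (fill_us D_cocycle charF (j := 1) (n := k.*2.+1)) t1 _;
  rewrite ?lc_depth2 //; try lia.
move=> {}t t1; apply: (fill_us D_cocycle charF (j := 2) (n := k.*2.+1)) t1 _;
  rewrite ?lc_depth2 //; try lia.
move=> {}t /(@tw_parity _ k.*2.+2) t1; apply: fill1; first exact: lc_cong_congr.
rewrite /lc_cong lc_depth2 !doubleS; apply: t1.
by rewrite /= negbK odd_double.
Qed.

End CharacteristicTwo.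

Lemma int_onto_Fp p (a : 'F_p) : exists z : int, a = z%:~R.
Proof. by exists (a : nat)%:Z; rewrite -pmulrn natr_Zp. Qed.

Lemma int_onto_int (a : int) : exists z : int, a = z%:~R.
Proof. by exists a; rewrite intz. Qed.

Theorem theorem1p1 (K : finComPzRingType) (p : nat) (Fq : finFieldType)
    (p_prime : prime p) (charFq : p \in [pchar Fq]) :
  [/\ profinite (riordan K),
      pro_p p (riordan Fq) /\ finite_width p (riordan Fq)
    & [/\ top_finitely_generated (riordan 'F_p),
          top_finitely_generated (riordan int),
          forall SN : set (nottingham 'F_p), top_generates SN ->
            top_generates ([set Riordan (us_1X 'F_p) 1%g] `|`
                           [set Riordan 1%g g | g in SN])
        & forall SN : set (nottingham int), top_generates SN ->
            top_generates ([set Riordan (us_1X int) 1%g] `|`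
                           [set Riordan 1%g g | g in SN])]].

Proof.
split; first exact: riordan_profinite.
  split; first exact: riordan_pro_p.
  have [p2|p_odd] := eqVneq p 2%N; last exact: finite_width_odd.
  by rewrite p2; apply: finite_width_char2; rewrite -p2.
split.
- exact: (riordan_tfg (@int_onto_Fp p)).
- exact: (riordan_tfg int_onto_int).
- exact: (riordan_top_generates (@int_onto_Fp p)).
- exact: (riordan_top_generates int_onto_int).
Qed.
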